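(* Let $G$ be a connected graph of order $n\ge 2$. Then $$\mathrm{LE}(G)\le \mathrm{LE}\bigl(\mathrm{PA}_{n,\,1+\lfloor 2n/3\rfloor}\bigr).$$
   Context: All graphs are finite and simple. The order of $G$ is its number of vertices $n$, and its size is its number of edges $m=|E(G)|$. The Laplacian matrix is $L(G)=D(G)-A(G)$ (degree matrix minus adjacency matrix), with eigenvalues listed with multiplicity in nonincreasing order $\mu_1(G)\ge\cdots\ge\mu_n(G)=0$. The Laplacian energy of $G$ is $\mathrm{LE}(G)=\sum_{i=1}^n\left|\mu_i(G)-\frac{2m}{n}\right|$. For integers $2\le\omega\le n$, the pineapple graph $\mathrm{PA}_{n,\omega}$ is the graph of order $n$ obtained from the complete graph $K_\omega$ by attaching $n-\omega$ pendant vertices, all to one and the same vertex of the clique. *)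

(* Defs.v *)
From mathcomp Require Import all_boot all_order all_algebra.
From mathcomp Require Import reals.
From mathcomp Require Import polyrcf complex.

Set Implicit Arguments.
Unset Strict Implicit.
Unset Printing Implicit Defensive.

Import Order.TTheory GRing.Theory Num.Theory.
Local Open Scope ring_scope.

Record sgraph (T : finType) := SGraph {
  adj :> rel T;
  adj_sym : symmetric adj;
  adj_irrefl : irreflexive adj
}.

Definition edge_set (T : finType) (G : sgraph T) : {set {set T}} :=
  [set [set p.1; p.2] | p in [set p : T * T | G p.1 p.2]].

Definition gsize (T : finType) (G : sgraph T) : nat := #|edge_set G|.

Definition vdegree (T : finType) (G : sgraph T) (x : T) : nat :=
  #|[set y | G x y]|.

Definition connected_graph (T : finType) (G : sgraph T) : Prop :=
  (0 < #|T|)%N /\ forall x y : T, connect G x y.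

Definition adjacency_mx (R : realType) (T : finType) (G : sgraph T) :
    'M[R]_#|T| :=
  \matrix_(i, j) (G (enum_val i) (enum_val j))%:R.

Definition degree_mx (R : realType) (T : finType) (G : sgraph T) :
    'M[R]_#|T| :=
  diag_mx (\row_i (vdegree G (enum_val i))%:R).

Definition laplacian_mx (R : realType) (T : finType) (G : sgraph T) :
    'M[R]_#|T| :=
  degree_mx R G - adjacency_mx R G.

(* The real eigenvalues of [A], repeated according to their multiplicity as
   roots of the characteristic polynomial, in nonincreasing order ([rootsR] is
   the increasing list of the distinct real roots). *)
Definition eigenvalues (R : realType) (n : nat) (A : 'M[R]_n) : seq R :=
  rev (flatten [seq nseq (mup x (char_poly A)) x | x <- rootsR (char_poly A)]).

Definition laplacian_energy (R : realType) (T : finType) (G : sgraph T) : R :=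
  \sum_(i < #|T|)
    `|(eigenvalues (laplacian_mx R G))`_i - (2 * gsize G)%:R / #|T|%:R|.

(* The clique is {0, ..., w-1} and the pendant vertices w, ..., n-1 are attached
   to 0; this is the pineapple graph for 2 <= w <= n. *)
Definition pineapple_adj (n w : nat) : rel 'I_n := fun i j =>
  (i != j) && [|| (i < w)%N && (j < w)%N,
                  (i == 0%N :> nat) && (w <= j)%N
                | (j == 0%N :> nat) && (w <= i)%N].

Lemma pineapple_sym n w : symmetric (@pineapple_adj n w).
Proof.
move=> i j; rewrite /pineapple_adj eq_sym andbC (andbC (i < w)%N).
by rewrite (orbC (_ && (w <= j)%N)) andbC.
Qed.

Lemma pineapple_irrefl n w : irreflexive (@pineapple_adj n w).
Proof. by move=> i; rewrite /pineapple_adj eqxx. Qed.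

Definition pineapple (n w : nat) : sgraph 'I_n :=
  SGraph (@pineapple_sym n w) (@pineapple_irrefl n w).

Lemma char_poly_conj (F : fieldType) (n : nat) (P D : 'M[F]_n) :
  P \in unitmx -> char_poly (invmx P *m D *m P) = char_poly D.
Proof.
move=> uP; rewrite /char_poly /char_poly_mx.
have PK : map_mx polyC (invmx P) *m map_mx polyC P = 1%:M.
  by rewrite -map_mxM mulVmx // map_mx1.
have -> : 'X%:M - map_mx polyC (invmx P *m D *m P) =
    map_mx polyC (invmx P) *m ('X%:M - map_mx polyC D) *m map_mx polyC P.
  rewrite mulmxBr mulmxBl -!map_mxM; congr (_ - _).
  by rewrite -mulmxA -scalar_mxC mulmxA PK mul1mx.
by rewrite !det_mulmx mulrAC -det_mulmx PK det1 mul1r.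
Qed.

Lemma symmetric_char_poly_split (R : realType) (n : nat) (A : 'M[R]_n) :
  A^T = A ->
  exists2 s : seq R, size s = n & char_poly A = \prod_(x <- s) ('X - x%:P).
Proof.
move=> symA; pose f := real_complex R; pose B := map_mx f A.
have realf x : f x \is Num.real by apply/complex_realP; exists x.
have hB : B \is hermsymmx.
  apply: realsym_hermsym.
    by apply/is_hermitianmxP; rewrite expr0 scale1r map_mx_id //; apply/matrixP => i j; rewrite !mxE -[in LHS]symA mxE.
  by apply/mxOverP => i j; rewrite mxE.
have /orthomx_spectralP defB := hermitian_normalmx hB.
have realD := hermitian_spectral_diag_real hB.
have dE i : spectral_diag B 0 i = f (complex.Re (spectral_diag B 0 i)).
  by have /mxOverP/(_ 0 i)/complex_realP [x ->] := realD.
exists [seq complex.Re (spectral_diag B 0 i) | i <- enum 'I_n].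
  by rewrite size_map size_enum_ord.
apply: (@map_poly_inj _ _ f).
rewrite map_char_poly -/B {1}defB char_poly_conj ?spectral_unit //.
rewrite char_poly_trig ?diag_mx_is_trig // rmorph_prod /= big_map big_enum /=.
by apply: eq_bigr => i _; rewrite map_polyXsubC mxE eqxx mulr1n {1}dE.
Qed.

Lemma eigenvalues_perm (R : realType) (n : nat) (A : 'M[R]_n) (s : seq R) :
  char_poly A = \prod_(x <- s) ('X - x%:P) -> perm_eq (eigenvalues A) s.
Proof.
move=> defs; rewrite /eigenvalues perm_rev.
have rootsE x : (x \in rootsR (char_poly A)) = (x \in s).
  have p0 : char_poly A != 0 by rewrite monic_neq0 ?char_poly_monic.
  by rewrite -roots_on_rootsR //= defs root_prod_XsubC.
apply/allP => x _ /=; apply/eqP; rewrite count_flatten -map_comp.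
rewrite sumnE big_map.
under eq_bigr => y _ do rewrite /= count_nseq /= defs mu_prod_XsubC.
have uR : uniq (rootsR (char_poly A)) by apply: uniq_roots.
case: (boolP (x \in rootsR (char_poly A))) => [xs | xNs].
  rewrite (bigD1_seq x) //= eqxx mul1n big1 ?addn0 // => y /negPf -> //.
rewrite big1_seq => [|y /andP[_ ys]].
  by apply/esym/count_memPn; rewrite -rootsE.
by case: eqP => // yx; rewrite -yx ys in xNs.
Qed.

(* For a real symmetric matrix of order n, [eigenvalues] is the full spectrum: n
   values, with multiplicity, in nonincreasing order. *)
Lemma size_eigenvalues (R : realType) (n : nat) (A : 'M[R]_n) :
  A^T = A -> size (eigenvalues A) = n.
Proof.
move=> /symmetric_char_poly_split [s szs defs].
by rewrite (perm_size (eigenvalues_perm defs)).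
Qed.

Lemma char_poly_eigenvalues (R : realType) (n : nat) (A : 'M[R]_n) :
  A^T = A -> char_poly A = \prod_(x <- eigenvalues A) ('X - x%:P).
Proof.
move=> /symmetric_char_poly_split [s szs defs].
by rewrite (perm_big _ (eigenvalues_perm defs)).
Qed.

Lemma sorted_eigenvalues (R : realType) (n : nat) (A : 'M[R]_n) :
  sorted >=%R (eigenvalues A).
Proof.
rewrite /eigenvalues rev_sorted.
have : sorted <%R (rootsR (char_poly A)) by apply: sorted_roots.
rewrite lt_sorted_pairwise sorted_pairwise; last exact: le_trans.
elim: (rootsR _) => //= x r IH /andP[/allP xr /IH {}IH].
rewrite pairwise_cat IH andbT; apply/andP; split; last first.
  by elim: (mup _ _) => //= k ->; rewrite andbT; apply/allP => y /nseqP[-> _].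
apply/allrelP => y z /nseqP[-> _] /flatten_mapP[t tr /nseqP[-> _]].
exact/ltW/xr.
Qed.

Lemma laplacian_mx_sym (R : realType) (T : finType) (G : sgraph T) :
  (laplacian_mx R G)^T = laplacian_mx R G.
Proof.
rewrite linearB /= tr_diag_mx; congr (_ - _).
by apply/matrixP => i j; rewrite !mxE adj_sym.
Qed.

(* Main.v *)
Require Import Defs.
From mathcomp Require Import all_classical topology normedtype sequences derive.
From mathcomp Require Import all_boot all_order all_algebra.
From mathcomp Require Import reals.
From mathcomp Require Import polyrcf complex.
From mathcomp Require Import zify ring lra.

(** Let [d = 2m/n]. The Laplacian eigenvalues sum to [2m], so that
    [LE(G) = 2 (tr(P L) - k d)], where [P] is the spectral projection for the
    eigenvalues above [d] and [k] is its rank. Here [tr(P L)] is the sum over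
    the edges [ij] of [u_ij = |P (e_i - e_j)|^2], and [P] annihilates constants.

    The key estimate bounds, for every vertex set [C], the sum of [u_ij] over
    the pairs inside [C] plus the sum of [(u_ij - 1)_+] over the pairs leaving
    [C] by [k |C|]. It is a bound on eigenvalue sums of weighted split graphs,
    proved by block-triangularising their Laplacian with a solution of a Riccati
    equation. It implies that [u_ij = w_ij + w_ji] for some weights
    [0 <= w_ij <= 1] all of whose row sums are [k]: at a minimiser of
    [sum_i (sum_j w_ij - k)^2], the rows with maximal sum would otherwise
    contradict the estimate.

    Bounding the trace of the square of [w] gives Brouwer's bound
    [tr(P L) <= m + k (k + 1) / 2], and [w] itself gives the Grone-Merris type
    bound [tr(P L) <= sum_i min(deg_i, k)]. Together with a bound from the
    second moments of the spectral measures at the vertices, these yield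
    [n (tr(P L) - k d) <= B] with
    [B = k* (k* + 1) (n - k* ) + (n - k* - 1) (n - 2 k* )] and
    [k* = floor(2 n / 3)]; only [deg_i >= 1] is used of connectedness. For the
    pineapple graph an explicit projection of rank [k*] shows
    [LE >= 2 B / n]. *)

Set Implicit Arguments.
Unset Strict Implicit.
Unset Printing Implicit Defensive.

Import Order.TTheory GRing.Theory Num.Theory.
Import numFieldNormedType.Exports.
Local Open Scope ring_scope.

(** * Functional calculus and projections *)

Section SpectralCalculus.
Local Open Scope sesquilinear_scope.
Variables (R : realType) (n : nat) (A : 'M[R]_n).
Hypothesis symA : A^T = A.

Let f := real_complex R.

Lemma real_diagonalization : exists (U : 'M[R[i]]_n) (d : 'I_n -> R),
  [/\ U \is unitarymx,
      map_mx f A = U^t* *m diag_mx (\row_i f (d i)) *m U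
    & char_poly A = \prod_(i < n) ('X - (d i)%:P)].
Proof.
pose B := map_mx f A.
have realf x : f x \is Num.real by apply/complex_realP; exists x.
have hB : B \is hermsymmx.
  apply: realsym_hermsym.
    by apply/is_hermitianmxP; rewrite expr0 scale1r map_mx_id //;
       apply/matrixP => i j; rewrite !mxE -[in LHS]symA mxE.
  by apply/mxOverP => i j; rewrite mxE.
have /orthomx_spectralP defB := hermitian_normalmx hB.
have realD := hermitian_spectral_diag_real hB.
have dE i : spectral_diag B 0 i = f (complex.Re (spectral_diag B 0 i)).
  by have /mxOverP/(_ 0 i)/complex_realP [x ->] := realD.
have sdE : spectral_diag B = \row_i f (complex.Re (spectral_diag B 0 i)).
  by apply/rowP => i; rewrite mxE -dE.
exists (spectralmx B), (fun i => complex.Re (spectral_diag B 0 i)); split.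
- exact: spectral_unitarymx.
- rewrite -/B {1}defB invmx_unitary ?spectral_unitarymx //.
  by rewrite [in LHS]sdE.
apply: (@map_poly_inj _ _ f).
rewrite map_char_poly -/B {1}defB char_poly_conj ?spectral_unit //.
rewrite char_poly_trig ?diag_mx_is_trig // rmorph_prod /=.
by apply: eq_bigr => i _; rewrite map_polyXsubC mxE eqxx mulr1n {1}dE.
Qed.

(* The matrix of [h(A)] is real because the conjugate of a unitary
   diagonalisation of [A] diagonalises [A] again. *)
Lemma spectral_calculus : exists F : (R -> R) -> 'M[R]_n,
  [/\ forall g, (F g)^T = F g,
      forall g h, F g *m F h = F (fun x => g x * h x),
      [/\ F id = A, forall t, F (fun=> t) = t%:M
        & forall g h, F g + F h = F (fun x => g x + h x)]
    & forall g, \tr (F g) = \sum_(x <- eigenvalues A) g x].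
Proof.
have [U [d [uU defA chA]]] := real_diagonalization.
have UV : U *m U^t* = 1%:M by apply/unitarymxP.
have VU : U^t* *m U = 1%:M by apply: mulmx1C.
have ped : perm_eq (eigenvalues A) [seq d i | i <- enum 'I_n].
  by apply: eigenvalues_perm; rewrite chA big_map big_enum.
pose M (g : R -> R) : 'M[R[i]]_n := U^t* *m diag_mx (\row_i f (g (d i))) *m U.
pose cj := map_mx (@Num.conj R[i]).
have cjf m1 m2 (N : 'M[R]_(m1, m2)) : cj _ _ (map_mx f N) = map_mx f N.
  apply/matrixP => i j; rewrite !mxE; apply/CrealP.
  by apply/complex_realP; eexists.
have cjM m1 m2 m3 (X : 'M_(m1, m2)) (Y : 'M_(m2, m3)) :
    cj _ _ (X *m Y) = cj _ _ X *m cj _ _ Y by rewrite /cj map_mxM.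
have dfE g : diag_mx (\row_i f (g (d i))) = map_mx f (diag_mx (\row_i g (d i))).
  by rewrite map_diag_mx; congr diag_mx; apply/rowP => i; rewrite !mxE.
have cjV : cj _ _ (U^t*) *m cj _ _ U = 1%:M.
  by have := cjM _ _ _ (U^t*) U; rewrite VU => <-; apply/matrixP => i j; rewrite !mxE rmorph_nat.
have cjU : cj _ _ U *m cj _ _ (U^t*) = 1%:M by apply: mulmx1C.
pose W := U *m cj _ _ (U^t*).
have WD : diag_mx (\row_i f (d i)) *m W = W *m diag_mx (\row_i f (d i)).
  have := cjf _ _ A; rewrite defA !cjM (dfE id) cjf => e.
  set D := map_mx f _ in e *.
  transitivity (U *m (U^t* *m D *m U) *m cj _ _ (U^t*)).
    by rewrite !mulmxA UV mul1mx.
  by rewrite -e !mulmxA -(mulmxA _ (cj _ _ U)) cjU mulmx1.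
(* [W] commutes with the diagonal matrix of [d], so [W i j] vanishes unless [d i = d j]; hence it
   also commutes with the diagonal matrix of any function of [d]. *)
have WG g : diag_mx (\row_i f (g (d i))) *m W = W *m diag_mx (\row_i f (g (d i))).
  move: {cjU cjV} W WD => W WD.
  apply/matrixP => i j; have /matrixP/(_ i j) := WD.
  rewrite !mul_diag_mx !mul_mx_diag !mxE.
  have [-> _|dij e] := eqVneq (d i) (d j); first by rewrite mulrC.
  suff -> : W i j = 0 by rewrite mulr0 mul0r.
  apply/eqP; move/eqP: e; rewrite [X in _ == X]mulrC -subr_eq0 -mulrBl mulf_eq0.
  case/orP => //; rewrite -rmorphB fmorph_eq0 subr_eq0 => /eqP h.
  by rewrite h eqxx in dij.
have WU : W *m cj _ _ U = U by rewrite /W -mulmxA cjV mulmx1.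
have UW : cj _ _ (U^t*) = U^t* *m W by rewrite /W mulmxA VU mul1mx.
have Mreal g : cj _ _ (M g) = M g.
  have GW := WG g; rewrite /M !cjM UW.
  have -> : cj _ _ (diag_mx (\row_i f (g (d i)))) = diag_mx (\row_i f (g (d i))).
    by rewrite dfE cjf.
  move: (diag_mx _) GW => G GW.
  by rewrite -(mulmxA _ W) -GW mulmxA -(mulmxA _ W) WU.
have exF g : {N : 'M[R]_n | map_mx f N = M g}.
  exists (map_mx (@complex.Re R) (M g)).
  move: (M g) (Mreal g) => N NR.
  apply/matrixP => i j; have /matrixP/(_ i j) := NR; rewrite !mxE => e.
  by have /complex_realP [x xE] : N i j \is Num.real; [apply/CrealP|rewrite xE].
pose F g := sval (exF g).
have FE g : map_mx f (F g) = M g by exact: (svalP (exF g)).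
have finj : injective (map_mx f : 'M[R]_n -> _) by apply: map_mx_inj.
have MM g h : M g *m M h = M (fun x => g x * h x).
  rewrite /M !mulmxA -(mulmxA _ U) UV mulmx1 -[_ *m diag_mx _ *m diag_mx _]mulmxA mulmx_diag.
  congr (_ *m diag_mx _ *m _); apply/rowP => i; rewrite !mxE.
  exact: (esym (rmorphM f _ _)).
exists F; split.
- move=> g; apply: finj; rewrite -map_trmx FE.
  have := congr1 trmx (Mreal g); rewrite {1}/M /cj !map_mxM !trmx_mul => <-.
  have -> : (map_mx Num.conj (diag_mx (\row_i f (g (d i)))))^T =
      diag_mx (\row_i f (g (d i))).
    by have := cjf _ _ (diag_mx (\row_i g (d i))); rewrite -dfE /cj => ->;
       rewrite tr_diag_mx.
  rewrite /M -[RHS]mulmxA; congr (_ *m _); first by rewrite map_trmx.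
  by congr (_ *m _); apply/matrixP => i j; rewrite !mxE; exact: conjCK.
- by move=> g h; apply: finj; rewrite map_mxM !FE MM.
- split.
  + by apply: finj; rewrite FE defA.
  + move=> t; apply: finj; rewrite FE map_scalar_mx /M.
    suff -> : diag_mx (\row_i f t) = (f t)%:M :> 'M[R[i]]_n.
      by rewrite mul_mx_scalar -scalemxAl VU scalemx1.
    by apply/matrixP => i j; rewrite !mxE.
  move=> g h; apply: finj; rewrite map_mxD !FE /M -mulmxDl -mulmxDr -raddfD.
  congr (_ *m diag_mx _ *m _).
  apply/rowP => i; rewrite !mxE; exact: (esym (rmorphD f _ _)).
move=> g; apply: (fmorph_inj f); rewrite -trace_map_mx FE /M mxtrace_mulC.
rewrite mulmxA UV mul1mx mxtrace_diag (perm_big _ ped) /= big_map big_enum.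
by rewrite rmorph_sum; apply: eq_bigr => i _; rewrite mxE.
Qed.

End SpectralCalculus.

Section Projections.
Variables (R : realType) (n : nat).
Implicit Types (A M P Q : 'M[R]_n).

Definition is_proj P := P^T = P /\ P *m P = P.

Lemma mxtrace_mul_tr m1 m2 (Q : 'M[R]_(m1, m2)) : 0 <= \tr (Q^T *m Q).
Proof.
rewrite /mxtrace; apply: sumr_ge0 => i _; rewrite mxE.
by apply: sumr_ge0 => j _; rewrite mxE -expr2 sqr_ge0.
Qed.

(** The trace is the squared Frobenius norm of [Q *m P]. *)
Lemma mxtrace_proj_sqr P Q : is_proj P -> Q^T = Q -> 0 <= \tr (P *m (Q *m Q)).
Proof.
move=> [sP PP] sQ; have := mxtrace_mul_tr (Q *m P).
rewrite trmx_mul sP sQ mulmxA mxtrace_mulC !mulmxA PP.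
by rewrite -mulmxA.
Qed.

Lemma is_projC P : is_proj P -> is_proj (1%:M - P).
Proof.
move=> [sP PP]; split; first by rewrite linearB /= trmx1 sP.
by rewrite mulmxBl mul1mx mulmxBr mulmx1 PP subrr subr0.
Qed.

(** Half of Ky Fan's principle. Write [M - t] as its positive part, the square of [F g], minus its
    negative part, the square of [F h]. The second has nonnegative trace against [P], and the first
    against [1 - P]. *)
Lemma trace_proj_le M P (t : R) : M^T = M -> is_proj P ->
  \tr (P *m M) - t * \tr P <= \sum_(x <- eigenvalues M) Num.max (x - t) 0.
Proof.
move=> symM pP; have [F [Fsym FM [Fid FC FD] Ftr]] := spectral_calculus symM.
pose g (x : R) := Num.sqrt (Num.max (x - t) 0); pose h (x : R) := Num.sqrt (Num.max (t - x) 0).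
have MF : M = t%:M + F g *m F g - F h *m F h.
  apply/eqP; rewrite eq_sym subr_eq -{1}Fid -FC !FM !FD; apply/eqP; congr F.
  rewrite funeqE => x.
  rewrite /g /h -!expr2 !sqr_sqrtr ?le_max ?lexx ?orbT //.
  by case: (lerP (x - t) 0) => x0; case: (lerP (t - x) 0) => y0; lra.
rewrite {1}MF mulmxBr mulmxDr linearB linearD /= mul_mx_scalar linearZ /=.
have P1 := mxtrace_proj_sqr pP (Fsym h).
have P2 := mxtrace_proj_sqr (is_projC pP) (Fsym g).
have -> : \sum_(x <- eigenvalues M) Num.max (x - t) 0 = \tr (F g *m F g).
  rewrite FM Ftr; apply: eq_bigr => x _.
  by rewrite /g -expr2 sqr_sqrtr ?le_max ?lexx ?orbT.
move: P2; rewrite mulmxBl mul1mx linearB /=; lra.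
Qed.

(** The indicator function of the values above [t], applied to [A], attains equality in
    [trace_proj_le]. *)
Lemma proj_above A (t : R) : A^T = A -> exists P, exists k : nat,
  [/\ is_proj P, P *m A = A *m P, \tr P = k%:R,
      \tr (P *m A) - t * k%:R = \sum_(x <- eigenvalues A) Num.max (x - t) 0
    & 0 <= t -> forall v : 'cV[R]_n, A *m v = 0 -> P *m v = 0].
Proof.
move=> symA; have [F [Fsym FM [Fid _ FD] Ftr]] := spectral_calculus symA.
pose g (x : R) : R := (t < x)%R%:R.
exists (F g), (count (fun x => t < x)%R (eigenvalues A)).
have trg : \tr (F g) = (count (fun x => t < x)%R (eigenvalues A))%:R.
  rewrite Ftr -sum1_count natr_sum [RHS]big_mkcond /=; apply: eq_bigr => x _.
  by rewrite /g; case: ltP.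
split=> //.
- split=> //; rewrite FM; congr F; rewrite funeqE => x.
  by rewrite /g; case: ltP; rewrite ?mulr1 ?mulr0.
- rewrite -[in LHS]Fid -[in RHS]Fid !FM; congr F; rewrite funeqE => x.
  by rewrite mulrC.
- rewrite -trg -{1}Fid FM !Ftr mulr_sumr -sumrB; apply: eq_bigr => x _.
  by rewrite /g /=; case: (ltP t x) => h; case: (lerP (x - t) 0) => h' /=; lra.
move=> t0 v Av.
(* For [0 <= t] the indicator is a multiple of the identity function, so the projection factors
   through [A] and kills its kernel. *)
have -> : F g = F (fun x => (t < x)%R%:R / x) *m A.
  rewrite -[X in _ *m X]Fid FM; congr F; rewrite funeqE => x.
  by rewrite /g; case: ltP => h; rewrite ?mul0r // mul1r mulVf // gt_eqF // (le_lt_trans t0).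
by rewrite -mulmxA Av mulmx0.
Qed.

End Projections.

(** * The Riccati equation of a weighted split graph *)

Section Riccati.
Local Open Scope classical_set_scope.
Local Open Scope ring_scope.
Variables (R : realType) (c o : nat) (B : 'M[R]_(c, o)).
Hypothesis B01 : forall i j, 0 < B i j < 1.

Let d i := \sum_j B i j.
Let db j := \sum_i (1 - B i j).

(* Its fixed points are the solutions of [Db Y + Y D = (1 - B)^T + Y B Y], with
   [D] and [Db] the diagonal matrices of [d] and [db]. *)
Definition riccati_step (Y : 'M[R]_(o, c)) : 'M[R]_(o, c) :=
  \matrix_(j, i) ((1 - B i j + (Y *m B *m Y) j i) / (d i + db j)).

Definition riccati_seq m := iter m riccati_step 0.

(** The slack of a row sum below 1. Its positivity along the iteration keeps the iterates
    bounded. *)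
Definition defect (Y : 'M[R]_(o, c)) j := 1 - \sum_i Y j i.

Local Lemma B_ge0 i j : 0 <= B i j. Proof. by have /andP[/ltW] := B01 i j. Qed.
Lemma B_gt0 i j : 0 < B i j. Proof. by have /andP[] := B01 i j. Qed.
Local Lemma B_lt1 i j : 0 < 1 - B i j. Proof. by have /andP[_] := B01 i j; rewrite subr_gt0. Qed.

Local Lemma d_gt0 i (j : 'I_o) : 0 < d i.
Proof.
rewrite /d (bigD1 j) //= ltr_pwDl ?B_gt0 //.
by apply: sumr_ge0 => l _; exact: B_ge0.
Qed.

Local Lemma db_gt0 j (i : 'I_c) : 0 < db j.
Proof.
rewrite /db (bigD1 i) //= ltr_pwDl ?B_lt1 //.
by apply: sumr_ge0 => l _; exact/ltW/B_lt1.
Qed.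

Local Lemma den_gt0 i j : 0 < d i + db j.
Proof. by rewrite addr_gt0 ?(d_gt0 i j) ?(db_gt0 j i). Qed.

Lemma quad_mono (Y Z : 'M[R]_(o, c)) : (forall j i, 0 <= Y j i) ->
  (forall j i, Y j i <= Z j i) ->
  forall j i, 0 <= (Y *m B *m Y) j i <= (Z *m B *m Z) j i.
Proof.
move=> Y0 YZ j i; rewrite !mxE; apply/andP; split.
  apply: sumr_ge0 => l _; apply: mulr_ge0 => //; rewrite mxE.
  by apply: sumr_ge0 => l' _; rewrite mulr_ge0 ?B_ge0.
apply: ler_sum => l _; apply: ler_pM => //.
  by rewrite mxE; apply: sumr_ge0 => l' _; rewrite mulr_ge0 ?B_ge0.
by rewrite !mxE; apply: ler_sum => l' _; apply: ler_wpM2r => //; exact: B_ge0.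
Qed.

Lemma riccati_step_mono (Y Z : 'M[R]_(o, c)) : (forall j i, 0 <= Y j i) ->
  (forall j i, Y j i <= Z j i) ->
  forall j i, riccati_step Y j i <= riccati_step Z j i.
Proof.
move=> Y0 YZ j i; rewrite mxE [X in _ <= X]mxE.
by rewrite ler_pM2r ?invr_gt0 ?den_gt0 // lerD2l; case/andP: (quad_mono Y0 YZ j i).
Qed.

Lemma riccati_seq1 j i : riccati_seq 1 j i = (1 - B i j) / (d i + db j).
Proof. by rewrite /riccati_seq /= mxE !mul0mx mxE addr0. Qed.

Lemma riccati_seq_mono m j i :
  0 <= riccati_seq m j i <= riccati_seq m.+1 j i.
Proof.
elim: m j i => [|m IH] j i.
  rewrite riccati_seq1 [riccati_seq 0 j i]mxE lexx /=.
  by rewrite divr_ge0 ?ltW ?den_gt0 ?B_lt1.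
apply/andP; split.
  by have /andP[a b] := IH j i; exact: le_trans b.
by apply: riccati_step_mono => j' i'; have /andP[] := IH j' i'.
Qed.

Lemma riccati_seq_gt0 m j i : 0 < riccati_seq m.+1 j i.
Proof.
elim: m => [|m IH]; last by apply: lt_le_trans IH _; case/andP: (riccati_seq_mono m.+1 j i).
by rewrite riccati_seq1 divr_gt0 ?den_gt0 ?B_lt1.
Qed.

(** With v the defect, B 1 = d and Y 1 = 1 - v, so that Y B Y 1 = Y d - Y B v. *)
Lemma sum_quad (Y : 'M[R]_(o, c)) j :
  \sum_i (Y *m B *m Y) j i = \sum_i Y j i * d i - \sum_l (Y *m B) j l * defect Y l.
Proof.
have -> : \sum_i Y j i * d i = \sum_l (Y *m B) j l.
  under [RHS]eq_bigr do rewrite mxE.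
  by rewrite exchange_big; apply: eq_bigr => i _; rewrite mulr_sumr.
rewrite -sumrB; under eq_bigr do rewrite mxE.
rewrite exchange_big; apply: eq_bigr => l _.
by rewrite -mulr_sumr /defect mulrBr mulr1 opprB addrC subrK.
Qed.

(** Summing the definition of the step over a row expresses the new defect by the increments and the
    old defects, all of them nonnegative along the iteration. *)
Lemma defect_step (Y : 'M[R]_(o, c)) j :
  db j * defect (riccati_step Y) j =
  \sum_i (riccati_step Y j i - Y j i) * d i + \sum_l (Y *m B) j l * defect Y l.
Proof.
have e : \sum_i riccati_step Y j i * (d i + db j) =
    db j + \sum_i (Y *m B *m Y) j i.
  rewrite /db -big_split; apply: eq_bigr => i _; rewrite mxE mulfVK //.
  by rewrite gt_eqF // den_gt0.
move: e; under eq_bigr do rewrite mulrDr.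
rewrite big_split -mulr_suml /= sum_quad => e.
under eq_bigr do rewrite mulrBl.
rewrite sumrB /defect; lra.
Qed.

Hypothesis c_gt0 : (0 < c)%N.
Let i0 := Ordinal c_gt0.

Lemma defect_gt0 m j : 0 < defect (riccati_seq m) j.
Proof.
elim: m j => [|m IH] j.
  by rewrite /defect big1 ?subr0 ?ltr01 // => i _; rewrite mxE.
rewrite -(pmulr_rgt0 _ (db_gt0 j i0)) defect_step.
have Y0 l i : 0 <= riccati_seq m l i by case/andP: (riccati_seq_mono m l i).
have h1 : 0 <= \sum_i (riccati_step (riccati_seq m) j i - riccati_seq m j i) * d i.
  apply: sumr_ge0 => i _; apply: mulr_ge0; last exact/ltW/(d_gt0 i j).
  by rewrite subr_ge0; case/andP: (riccati_seq_mono m j i).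
have h2 : 0 <= \sum_l (riccati_seq m *m B) j l * defect (riccati_seq m) l.
  apply: sumr_ge0 => l _; apply: mulr_ge0; last exact/ltW.
  by rewrite mxE; apply: sumr_ge0 => l' _; rewrite mulr_ge0 ?B_ge0.
(* At the first step the iterate is 0 and strictness comes from the increments; afterwards it comes
   from the old defects, whose coefficients are then positive. *)
case: m {IH} Y0 h1 h2 (IH) => [|m] Y0 h1 h2 IH.
  rewrite ltr_pwDl // (bigD1 i0) //= ltr_pwDl //.
    rewrite [X in _ - X]mxE subr0 mulr_gt0 ?(d_gt0 _ j) //.
    exact: (riccati_seq_gt0 0).
  apply: sumr_ge0 => i _; rewrite [X in _ - X]mxE subr0.
  by rewrite mulr_ge0 ?ltW ?(d_gt0 _ j) //; exact: (riccati_seq_gt0 0).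
rewrite ltr_wpDl // (bigD1 j) //= ltr_pwDl //.
  rewrite mulr_gt0 // mxE (bigD1 i0) //= ltr_pwDl //.
    by rewrite mulr_gt0 ?B_gt0 // riccati_seq_gt0.
  by apply: sumr_ge0 => l' _; rewrite mulr_ge0 ?B_ge0.
apply: sumr_ge0 => l _; rewrite mulr_ge0 ?(ltW (IH _)) // mxE.
by apply: sumr_ge0 => l' _; rewrite mulr_ge0 ?B_ge0.
Qed.

Lemma riccati_seq_le1 m j i : riccati_seq m j i <= 1.
Proof.
have := defect_gt0 m j; rewrite /defect (bigD1 i) //= => h.
have : 0 <= \sum_(l | l != i) riccati_seq m j l.
  by apply: sumr_ge0 => l _; case/andP: (riccati_seq_mono m j l).
lra.
Qed.

Lemma riccati_cvg : exists Y : 'M[R]_(o, c),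
  forall j i, (fun m => riccati_seq m j i) @ \oo --> Y j i.
Proof.
exists (\matrix_(j, i) sup (range (fun m => riccati_seq m j i))) => j i.
rewrite mxE; apply: nondecreasing_cvgn.
  by apply/nondecreasing_seqP => m; case/andP: (riccati_seq_mono m j i).
by exists 1 => _ [m _ <-]; exact: riccati_seq_le1.
Qed.

(* Weighted diagonal dominance; letting [rho] vanish this says that
   [K - diag db] has no positive eigenvalue. *)
Lemma dominance_bound (K : 'M[R]_o) (v rho delta : 'I_o -> R) (g X : R) :
  (forall j l, 0 <= K j l) -> (forall j, 0 < v j) -> (forall j, 0 <= rho j) ->
  0 < g -> 0 <= X ->
  (forall j, db j * v j = \sum_l K j l * v l + rho j) ->
  (forall j, `|(g + db j) * delta j - \sum_l K j l * delta l| <= X * rho j) ->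
  forall l, `|delta l| <= X * v l.
Proof.
move=> K0 v0 rho0 g0 X0 hv hd l.
(* At an index [j] that maximises the ratio of [|delta|] to [v], with maximum [q], the hypotheses
   give [q * (g * v j + rho j) <= X * rho j], hence [q <= X]. *)
have [j _ jmax] := @Order.TotalTheory.arg_maxP _ _ _ l xpredT (fun l => `|delta l| / v l) isT.
set q := `|delta j| / v j in jmax.
have q0 : 0 <= q by rewrite divr_ge0 // ltW.
have qle l' : `|delta l'| <= q * v l'.
  by rewrite -ler_pdivrMr //; exact: (jmax l' isT).
have qj : `|delta j| = q * v j by rewrite /q mulfVK // gt_eqF.
suff qX : q <= X by apply: le_trans (qle l) _; rewrite ler_wpM2r // ltW.
have dbj0 : 0 < db j by exact: (db_gt0 j i0).
have h1 : (g + db j) * (q * v j) <= X * rho j + q * (\sum_l K j l * v l).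
  rewrite -qj -[X in X * `|_|]gtr0_norm ?addr_gt0 // -normrM.
  have := hd j; set S := \sum_l _ => hS.
  have : `|S| <= q * (\sum_l K j l * v l).
    apply: le_trans (ler_norm_sum _ _ _) _; rewrite mulr_sumr.
    apply: ler_sum => l' _; rewrite normrM ger0_norm // mulrCA.
    by rewrite ler_wpM2l.
  have := ler_normB ((g + db j) * delta j - S) (- S); rewrite opprK subrK normrN.
  lra.
have h2 := hv j.
have h3 : q * (g * v j + rho j) <= X * rho j by nra.
have gv : 0 < g * v j by rewrite mulr_gt0.
have := rho0 j; nra.
Qed.

(** The error of [Y] in the Riccati equation; it vanishes exactly at the fixed points of
    [riccati_step]. *)
Definition residue (Y : 'M[R]_(o, c)) j i :=
  1 - B i j - Y j i * (d i + db j) + (Y *m B *m Y) j i.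

Lemma residue_sum (Y : 'M[R]_(o, c)) j :
  db j * defect Y j = \sum_l (Y *m B) j l * defect Y l + \sum_i residue Y j i.
Proof.
rewrite /residue big_split /= sum_quad sumrB -/(db j).
have -> : \sum_i Y j i * (d i + db j) = \sum_i Y j i * d i + (\sum_i Y j i) * db j.
  by rewrite mulr_suml -big_split; apply: eq_bigr => i _; rewrite mulrDr.
rewrite /defect; ring.
Qed.

Lemma residue_seq m j i : 0 <= residue (riccati_seq m) j i.
Proof.
have -> : residue (riccati_seq m) j i =
    (riccati_seq m.+1 j i - riccati_seq m j i) * (d i + db j).
  rewrite mulrBl [riccati_seq m.+1]/= [riccati_step _ j i]mxE mulfVK /residue; first lra.
  by rewrite gt_eqF // den_gt0.
by rewrite mulr_ge0 ?(ltW (den_gt0 _ _)) // subr_ge0; case/andP: (riccati_seq_mono m j i).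
Qed.

(** * Eigenvectors of the split matrix for a positive eigenvalue *)

Section PositiveEigenvector.
Variables (g : R) (x : 'I_c -> R) (z : 'I_o -> R).
Hypothesis g_gt0 : 0 < g.
Let s := \sum_i x i.
Hypothesis eqC : forall i, d i * x i - s - \sum_j B i j * z j = g * x i.
Hypothesis eqO : forall j, - (\sum_i B i j * x i) - db j * z j = g * z j.

Let delta (Y : 'M[R]_(o, c)) j := z j - \sum_i Y j i * x i + s / g * defect Y j.

(** [delta] is the error in the formula of [riccati_limit] for the part [z] of the eigenvector. The
    eigenvector equations yield a diagonally dominant linear system for it, driven only by the
    residue of [Y]. *)
Lemma deltaE (Y : 'M[R]_(o, c)) j :
  (g + db j) * delta Y j - \sum_l (Y *m B) j l * delta Y l =
  \sum_i residue Y j i * (x i + s / g).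
Proof.
have KE (w : 'I_o -> R) :
    \sum_l (Y *m B) j l * w l = \sum_i Y j i * \sum_l B i l * w l.
  under eq_bigr do rewrite mxE mulr_suml.
  rewrite exchange_big; apply: eq_bigr => i _; rewrite mulr_sumr.
  by apply: eq_bigr => l _; rewrite mulrA.
have Kz : \sum_l (Y *m B) j l * z l = \sum_i Y j i * (d i * x i - s - g * x i).
  by rewrite KE; apply: eq_bigr => i _; congr (_ * _); have := eqC i; lra.
have KY : \sum_l (Y *m B) j l * (\sum_i Y l i * x i) =
    \sum_i (Y *m B *m Y) j i * x i.
  under [RHS]eq_bigr do rewrite mxE mulr_suml.
  rewrite exchange_big; apply: eq_bigr => l _; rewrite mulr_sumr.
  by apply: eq_bigr => i _; rewrite mulrA.
have -> : \sum_l (Y *m B) j l * delta Y l =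
    \sum_l (Y *m B) j l * z l - \sum_l (Y *m B) j l * (\sum_i Y l i * x i)
    + s / g * \sum_l (Y *m B) j l * defect Y l.
  rewrite mulr_sumr -sumrB -big_split; apply: eq_bigr => l _ /=.
  by rewrite /delta; ring.
rewrite Kz KY; under [RHS]eq_bigr do rewrite mulrDr.
rewrite big_split -mulr_suml /=.
have -> : \sum_i residue Y j i * x i = s - \sum_i B i j * x i -
    \sum_i Y j i * (d i * x i) - db j * (\sum_i Y j i * x i)
    + \sum_i (Y *m B *m Y) j i * x i.
  rewrite /s mulr_sumr -!sumrB -big_split; apply: eq_bigr => i _ /=.
  by rewrite /residue; ring.
have -> : \sum_i Y j i * (d i * x i - s - g * x i) =
    \sum_i Y j i * (d i * x i) - s * (\sum_i Y j i) - g * (\sum_i Y j i * x i).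
  by rewrite !mulr_sumr -!sumrB; apply: eq_bigr => i _ /=; ring.
have hS := residue_sum Y j; have hO := eqO j.
have -> : \sum_i residue Y j i =
    db j * defect Y j - \sum_l (Y *m B) j l * defect Y l by lra.
have -> : \sum_i B i j * x i = - (g * z j) - db j * z j by lra.
rewrite /delta; have -> : \sum_i Y j i = 1 - defect Y j by rewrite /defect; lra.
by field; rewrite gt_eqF.
Qed.

(** The bound is proved before passing to the limit: [dominance_bound] asks for a positive [v],
    whereas the defect of the limit may vanish. *)
Lemma delta_bound m l :
  `|delta (riccati_seq m) l| <=
  (\sum_i `|x i + s / g|) * defect (riccati_seq m) l.
Proof.
apply: (@dominance_bound (riccati_seq m *m B) _
   (fun j => \sum_i residue (riccati_seq m) j i) _ g).
- move=> j l'; rewrite mxE; apply: sumr_ge0 => i _.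
  by rewrite mulr_ge0 ?B_ge0 //; case/andP: (riccati_seq_mono m j i).
- by move=> j; exact: defect_gt0.
- by move=> j; apply: sumr_ge0 => i _; exact: residue_seq.
- exact: g_gt0.
- exact: sumr_ge0.
- by move=> j; rewrite residue_sum.
move=> j; rewrite deltaE; apply: le_trans (ler_norm_sum _ _ _) _.
rewrite mulr_sumr; apply: ler_sum => i _; rewrite normrM.
rewrite ger0_norm ?residue_seq // mulrC ler_wpM2r ?residue_seq //.
by rewrite (bigD1 i) //= lerDl sumr_ge0.
Qed.

End PositiveEigenvector.

(** The last clause says that an eigenvector of [split_mx B] for a positive eigenvalue is determined
    by its clique part [x]. It serves to exclude positive eigenvalues of the block [A2] in
    [split_trace_pos]. *)
Lemma riccati_limit : exists Y : 'M[R]_(o, c),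
  [/\ forall j i, 0 < Y j i,
      forall j i, residue Y j i = 0,
      forall j, 0 <= defect Y j
    & forall g (x : 'I_c -> R) (z : 'I_o -> R), 0 < g ->
      (forall i, d i * x i - \sum_i x i - \sum_j B i j * z j = g * x i) ->
      (forall j, - (\sum_i B i j * x i) - db j * z j = g * z j) ->
      forall j, z j = \sum_i Y j i * x i - (\sum_i x i) / g * defect Y j].
Proof.
have [Y Ycvg] := riccati_cvg.
have Y0 j i : 0 < Y j i.
  apply: lt_le_trans (riccati_seq_gt0 0 j i) _.
  have inc : nondecreasing_seq (fun m => riccati_seq m j i).
    by apply/nondecreasing_seqP => m; case/andP: (riccati_seq_mono m j i).
  have := nondecreasing_cvgn_le inc (cvgP _ (Ycvg j i)) 1%N.
  by rewrite (cvg_lim _ (Ycvg j i)).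
have quad_cvg j i : (fun m => (riccati_seq m *m B *m riccati_seq m) j i) @ \oo -->
    (Y *m B *m Y) j i.
  rewrite mxE; under eq_fun do rewrite mxE.
  apply: (cvg_big add_continuous) => l _; apply: cvgM; last exact: Ycvg.
  rewrite mxE; under eq_fun do rewrite mxE.
  by apply: (cvg_big add_continuous) => i' _; apply: cvgM; [exact: Ycvg|exact: cvg_cst].
have res0 j i : residue Y j i = 0.
  have h1 : (fun m => riccati_seq m.+1 j i * (d i + db j)) @ \oo -->
      Y j i * (d i + db j).
    apply: cvgM; last exact: cvg_cst.
    by have := Ycvg j i; rewrite -(cvg_shiftS (fun m => riccati_seq m j i)).
  have h2 : (fun m => riccati_seq m.+1 j i * (d i + db j)) @ \oo -->
      (1 - B i j) + (Y *m B *m Y) j i.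
    have -> : (fun m => riccati_seq m.+1 j i * (d i + db j)) =
        (fun m => (1 - B i j) + (riccati_seq m *m B *m riccati_seq m) j i).
      rewrite funeqE => m; rewrite [riccati_seq m.+1]/= [riccati_step _ j i]mxE mulfVK //.
      by rewrite gt_eqF // den_gt0.
    by apply: cvgD; [exact: cvg_cst|exact: quad_cvg].
  have h := cvg_unique (@Rhausdorff R) h1 h2; rewrite /residue h; ring.
have lin_cvg j (w : 'I_c -> R) : (fun m => \sum_i riccati_seq m j i * w i) @ \oo -->
    \sum_i Y j i * w i.
  by apply: (cvg_big add_continuous) => i _; apply: cvgM; [exact: Ycvg|exact: cvg_cst].
have def_cvg j : (fun m => defect (riccati_seq m) j) @ \oo --> defect Y j.
  by apply: cvgB; [exact: cvg_cst|apply: (cvg_big add_continuous) => i _; exact: Ycvg].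
have def0 j : 0 <= defect Y j.
  by apply: (cvgr_to_ge (def_cvg j)); near=> m; exact/ltW/defect_gt0.
exists Y; split=> // g x z g0 eqC eqO j.
set s := \sum_i x i; pose X := \sum_i `|x i + s / g|.
pose delta (Y : 'M[R]_(o, c)) j := z j - \sum_i Y j i * x i + s / g * defect Y j.
have delta_cvg l : (fun m => delta (riccati_seq m) l) @ \oo --> delta Y l.
  apply: cvgD; first by apply: cvgB; [exact: cvg_cst|exact: lin_cvg].
  by apply: cvgM; [exact: cvg_cst|exact: def_cvg].
have bound l : `|delta Y l| <= X * defect Y l.
  apply: (ler_cvg_to (cvg_norm (delta_cvg l)) (cvgM (cvg_cst X) (def_cvg l))).
  by near=> m; exact: delta_bound.
suff : delta Y j = 0 by rewrite /delta; lra.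
have hdef l : db l * defect Y l = \sum_l' (Y *m B) l l' * defect Y l'.
  by rewrite residue_sum [X in _ + X]big1 ?addr0.
have YB0 l l' : 0 < (Y *m B) l l'.
  rewrite mxE (bigD1 i0) //= ltr_pwDl ?mulr_gt0 ?B_gt0 //.
  by apply: sumr_ge0 => i _; rewrite mulr_ge0 ?B_ge0 // ltW.
(* As [Y *m B] is positive, one vanishing defect forces all to vanish, and then [bound] suffices.
   Otherwise the defect is a positive [v] for [dominance_bound] with zero right-hand side. *)
have [[l vl0]|vpos] := pselect (exists l, defect Y l = 0).
  have v0 : defect Y j = 0.
    have := hdef l; rewrite vl0 mulr0 => /esym/eqP.
    rewrite psumr_eq0; last by move=> l' _; rewrite mulr_ge0 // ltW.
    by move=> /allP/(_ j (mem_index_enum _)) /=; rewrite mulf_eq0 gt_eqF //= => /eqP.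
  by have := bound j; rewrite v0 mulr0 normr_le0 => /eqP.
have vp l : 0 < defect Y l.
  by rewrite lt_def def0 andbT; apply/eqP => h; apply: vpos; exists l.
apply/eqP; rewrite -normr_le0 -(mul0r (defect Y j)).
apply: (@dominance_bound (Y *m B) _ (fun=> 0) _ g) => //.
- by move=> l l'; exact: ltW.
- by move=> l; rewrite addr0.
move=> l; rewrite mulr0 normr_le0 /delta (deltaE g0 eqC eqO).
by apply/eqP/big1 => i _; rewrite res0 mul0r.
Unshelve. all: by end_near.
Qed.

End Riccati.

(** * Eigenvalue sums of weighted split graphs *)

Lemma char_poly_ublock (F : comNzRingType) m n (A : 'M[F]_m) B (D : 'M[F]_n) :
  char_poly (block_mx A B 0 D) = char_poly A * char_poly D.
Proof.
rewrite /char_poly /char_poly_mx map_block_mx /= map_mx0.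
by rewrite scalar_mx_block opp_block_mx add_block_mx subr0 det_ublock.
Qed.

Lemma char_poly_similar (F : fieldType) n (A D Q : 'M[F]_n) :
  Q \in unitmx -> A *m Q = Q *m D -> char_poly A = char_poly D.
Proof.
move=> uQ e; rewrite -(@char_poly_conj _ _ (invmx Q) D) ?unitmx_inv //.
by rewrite invmxK -e mulmxK.
Qed.

Lemma unitmx_lblock1 (F : fieldType) m n (Y : 'M[F]_(n, m)) :
  block_mx 1%:M 0 Y 1%:M \in unitmx.
Proof. by rewrite unitmxE det_lblock !det1 mulr1 unitr1. Qed.

(** [H + e *m f] kills [e], so the eigenvalue [- a] of [H] moves to 0. Bordering by one row and
    column turns this into the similarity of two block triangular matrices, whatever the other
    eigenvectors are. *)
Lemma char_poly_rank1 (F : fieldType) n (H : 'M[F]_n) (e : 'cV_n) (f : 'rV_n) a :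
  f *m e = a%:M -> H *m e = - a *: e ->
  'X * char_poly H = ('X + a%:P) * char_poly (H + e *m f).
Proof.
move=> fe He; pose Q := block_mx (1%:M : 'M_1) 0 e 1%:M.
have uQ : Q \in unitmx by apply: unitmx_lblock1.
have e1 : block_mx ((- a)%:M : 'M_1) f 0 (H + e *m f) *m Q =
    Q *m block_mx (0%:M : 'M_1) f 0 H.
  rewrite raddf0 !mulmx_block !mulmx1 !mul1mx !mul0mx !mulmx0 !addr0 !add0r mulmxDl.
  rewrite fe He -mulmxA fe mul_mx_scalar -scalerDl addNr scale0r.
  by rewrite raddfN /= addNr addrC.
have c1 (b : F) : char_poly (b%:M : 'M_1) = 'X - b%:P.
  by rewrite char_poly_trig ?mx11_is_trig // big_ord1 mxE.
have := char_poly_similar uQ e1.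
rewrite !char_poly_ublock !c1 polyCN opprK.
by rewrite polyC0 subr0 => <-.
Qed.

Lemma char_poly_roots_trace (F : fieldType) n (A : 'M[F]_n) (s : seq F) :
  char_poly A = \prod_(x <- s) ('X - x%:P) -> \tr A = \sum_(x <- s) x.
Proof.
move=> e; have szs : size s = n.
  by apply/succn_inj; rewrite -(size_prod_XsubC s id) -e size_char_poly.
case: n A e szs => [|n] A e szs.
  by rewrite (size0nil szs) big_nil /mxtrace big_ord0.
apply: oppr_inj; rewrite -char_poly_trace // e -szs coefPn_prod_XsubC //.
by rewrite szs.
Qed.

Lemma char_poly_trmx (F : comNzRingType) n (A : 'M[F]_n) : char_poly A^T = char_poly A.
Proof.
rewrite /char_poly -[RHS]det_tr; congr (\det _).
by apply/matrixP => i j; rewrite !mxE eq_sym.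
Qed.

Lemma eigenvalue_right (F : fieldType) n (A : 'M[F]_n) x :
  root (char_poly A) x -> exists2 v : 'cV_n, A *m v = x *: v & v != 0.
Proof.
rewrite -char_poly_trmx -eigenvalue_root_char => /eigenvalueP[v vA v0].
exists v^T; last by rewrite trmx_eq0.
by rewrite -[A]trmxK -trmx_mul vA linearZ.
Qed.

(** Gershgorin's argument: at a coordinate of largest modulus of an eigenvector, a negative [x]
    contradicts diagonal dominance. *)
Lemma eigenvalue_dominant_ge0 (R : realFieldType) n (A : 'M[R]_n) x :
  (forall i j, i != j -> A i j <= 0) -> (forall i, 0 <= \sum_j A i j) ->
  root (char_poly A) x -> 0 <= x.
Proof.
move=> offd rows /eigenvalue_right[v Av /cV0Pn[l vl]].
have [i _ imax] := @arg_maxP _ _ _ l xpredT (fun i => `|v i 0|) isT.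
have vi : 0 < `|v i 0|.
  by apply: lt_le_trans (imax l isT); rewrite normr_gt0.
rewrite leNgt; apply/negP => x0.
have := congr1 (fun M : 'cV_n => M i 0) Av; rewrite /= !mxE (bigD1 i) //= => e.
have h := rows i; rewrite (bigD1 i) //= in h.
have : `|\sum_(j | j != i) A i j * v j 0| <= - (\sum_(j | j != i) A i j) * `|v i 0|.
  apply: le_trans (ler_norm_sum _ _ _) _; rewrite -sumrN mulr_suml.
  apply: ler_sum => j ji; rewrite normrM ler0_norm ?offd 1?eq_sym //.
  apply: ler_wpM2l; first by rewrite oppr_ge0 offd // eq_sym.
  exact: (imax j isT).
have -> : \sum_(j | j != i) A i j * v j 0 = - ((A i i - x) * v i 0) by lra.
rewrite normrN normrM => h2.
have h3 : 0 <= A i i.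
  have : \sum_(j | j != i) A i j <= 0 by apply: sumr_le0 => j ji; rewrite offd // eq_sym.
  lra.
rewrite (ger0_norm (_ : 0 <= A i i - x)) ?subr_ge0 ?(le_trans (ltW x0)) // in h2.
rewrite ler_pM2r // in h2; clear Av; lra.
Qed.

Lemma sum_diag_mx (R : pzRingType) n (d : 'rV[R]_n) i (w : 'I_n -> R) :
  \sum_j diag_mx d i j * w j = d 0 i * w i.
Proof.
rewrite (bigD1 i) //= big1 ?addr0 => [|j ji]; rewrite mxE ?eqxx ?mulr1n //.
by rewrite eq_sym (negPf ji) mulr0n mul0r.
Qed.

Section SplitMatrix.
Variables (R : realType) (c o : nat).
Implicit Type B : 'M[R]_(c, o).

(* The Laplacian of the graph with a clique on the first [c] vertices and weights
   [B i j] between the two parts, minus [c] times the identity. *)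
Definition split_mx B : 'M[R]_(c + o) :=
  block_mx (diag_mx (\row_i \sum_j B i j) - const_mx 1) (- B)
           (- B^T) (- diag_mx (\row_j \sum_i (1 - B i j))).

Lemma split_mx_sym B : (split_mx B)^T = split_mx B.
Proof.
rewrite /split_mx tr_block_mx !linearN /= trmxK linearB /= !tr_diag_mx.
by rewrite trmx_const.
Qed.

(* Adding the rank one matrix [e *m f] only moves the eigenvalue [- c] of
   [split_mx B] to [0], and the result is similar to a block triangular matrix
   with diagonal blocks [A1 = D - B Y] and [A2 = Y B - Db], where [Y] solves the
   Riccati equation. As [A1] has nonnegative and [A2] nonpositive spectrum, the
   positive eigenvalues of [split_mx B] sum to [tr A1]. *)
Lemma split_trace_pos B (P : 'M[R]_(c + o)) :
  (0 < c)%N -> (forall i j, 0 < B i j < 1) -> is_proj P ->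
  \tr (P *m split_mx B) <= \sum_i \sum_j B i j.
Proof.
move=> c0 B01 pP; have [Y [Y0 res v0 pev]] := riccati_limit B01 c0.
have := trace_proj_le 0 (split_mx_sym B) pP; rewrite mul0r subr0 => /le_trans; apply.
rewrite (eq_bigr (fun x => Num.max x 0)) => [|x _]; last by rewrite subr0.
pose D := diag_mx (\row_i \sum_j B i j).
pose Db := diag_mx (\row_j \sum_i (1 - B i j)).
pose A1 := D - B *m Y; pose A2 := Y *m B - Db.
pose e : 'cV[R]_(c + o) := const_mx 1.
pose f : 'rV[R]_(c + o) := row_mx (const_mx 1) 0.
have fe : f *m e = c%:R%:M.
  rewrite /f /e -(@col_mx_const _ c o 1) mul_row_col mul0mx addr0.
  apply/matrixP => i j; rewrite !mxE !ord1 eqxx mulr1n.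
  by under eq_bigr do rewrite !mxE mulr1; rewrite sumr_const card_ord.
have He : split_mx B *m e = - c%:R *: e.
  rewrite /e -(@col_mx_const _ c o 1) mul_block_col scale_col_mx.
  congr col_mx; apply/colP => i; rewrite !mxE.
    rewrite (eq_bigr (fun l => D i l * 1 - 1)); last by move=> l _; rewrite mulr1 !mxE mulr1.
    rewrite [X in _ + X](eq_bigr (fun l => - B i l)); last by move=> l _; rewrite !mxE mulr1.
    by rewrite sumrB sum_diag_mx mxE sumr_const card_ord sumrN; ring.
  rewrite (eq_bigr (fun l => - B l i)); last by move=> l _; rewrite !mxE mulr1.
  rewrite [X in _ + X](eq_bigr (fun l => Db i l * (- 1))); last first.
    by move=> l _; rewrite !mxE mulr1 mulrN1.
  by rewrite sum_diag_mx mxE sumrN sumrB sumr_const card_ord; ring.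
have ric : const_mx 1 - B^T = Y *m D + Db *m Y - Y *m B *m Y.
  apply/matrixP => j i; have := res j i; rewrite /residue /D /Db.
  rewrite mul_mx_diag mul_diag_mx; move: (Y *m B *m Y) => M; rewrite !mxE; lra.
have NE : split_mx B + e *m f = block_mx D (- B) (const_mx 1 - B^T) (- Db).
  rewrite /e -(@col_mx_const _ c o 1) /f mul_col_row !mulmx0.
  have J1 m : (const_mx 1 : 'cV_m) *m const_mx 1 = const_mx 1 :> 'M[R]_(m, c).
    by apply/matrixP => i j; rewrite !mxE big_ord1 !mxE mulr1.
  rewrite !J1 add_block_mx !addr0 subrK; congr block_mx.
  by rewrite addrC.
have chN : char_poly (split_mx B + e *m f) = char_poly A1 * char_poly A2.
  rewrite -(char_poly_ublock A1 (- B)) NE.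
  apply: (char_poly_similar (unitmx_lblock1 Y)).
  rewrite !mulmx_block !mulmx1 !mul1mx !mulmx0 !mul0mx !addr0 !add0r ric.
  rewrite /A1 /A2 mulmxBr mulmxA !mulNmx !mulmxN.
  by congr block_mx; rewrite ?addKr // addrAC addrK.
have chH := char_poly_rank1 fe He.
rewrite chN in chH.
have chE := char_poly_eigenvalues (split_mx_sym B).
set E := eigenvalues _ in chE *.
have chE' : \prod_(x <- 0 :: E) ('X - x%:P) =
    ('X + c%:R%:P) * (char_poly A1 * char_poly A2).
  by rewrite big_cons polyC0 subr0 -chE.
(* [A1] and [A2] need not be symmetric; their characteristic polynomials split over [R] because they
   divide a product of real linear factors. *)
have splitp (p : {poly R}) : p \is monic -> p %| \prod_(x <- 0 :: E) ('X - x%:P) ->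
    exists s : seq R, p = \prod_(x <- s) ('X - x%:P).
  move=> mp /dvdp_prod_XsubC[m]; rewrite eqp_monic ?monic_prod_XsubC // => /eqP.
  by exists (mask m (0 :: E)).
have [s1 e1] : exists s : seq R, char_poly A1 = \prod_(x <- s) ('X - x%:P).
  apply: splitp; first exact: char_poly_monic.
  by rewrite chE' mulrCA dvdp_mulr.
have [s2 e2] : exists s : seq R, char_poly A2 = \prod_(x <- s) ('X - x%:P).
  apply: splitp; first exact: char_poly_monic.
  by rewrite chE' mulrA dvdp_mull.
have pe : perm_eq (0 :: E) (- c%:R :: s1 ++ s2).
  by apply: prod_XsubC_eq; rewrite chE' e1 e2 !big_cons big_cat polyCN opprK.
have s1_ge0 x : x \in s1 -> 0 <= x.
  move=> xs; apply: (@eigenvalue_dominant_ge0 _ _ A1); last first.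
  - by rewrite e1 root_prod_XsubC.
  - move=> i; rewrite (eq_bigr (fun j => D i j * 1 - \sum_l B i l * Y l j)); last first.
      by move=> j _; rewrite mulr1 !mxE.
    rewrite sumrB sum_diag_mx mxE mulr1 exchange_big -sumrB.
    apply: sumr_ge0 => l _; rewrite -mulr_sumr -[X in X - _]mulr1 -mulrBr.
    by rewrite mulr_ge0 ?v0 // (ltW (B_gt0 _ _ _)).
  move=> i j ij; rewrite !mxE (negPf ij) mulr0n sub0r oppr_le0.
  apply: sumr_ge0 => l _; rewrite mulr_ge0 ?(ltW (Y0 _ _)) //.
  by have /andP[/ltW] := B01 i l.
have s2_le0 x : x \in s2 -> x <= 0.
  rewrite -root_prod_XsubC -e2 -eigenvalue_root_char => /eigenvalueP[z zA z0].
  rewrite leNgt; apply/negP => x0.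
  (* The row [z] extends by [xi] to an eigenvector of [split_mx B] whose coordinates sum to 0.
     Pairing the formula [pev] for [z] with [z] itself then gives |z|^2 = - |xi|^2, so [z]
     vanishes. *)
  pose xi := - (z *m Y).
  have zB : - xi *m B = x *: z + z *m Db.
    by rewrite opprK -zA /A2 mulmxBr mulmxA subrK.
  have zR : xi *m D + z *m (const_mx 1 - B^T) = x *: xi.
    rewrite ric !mulmxDr mulmxN /xi scalerN scalemxAl -zA /A2 mulmxBr mulmxBl.
    by rewrite !mulNmx !mulmxA addrA addrA addNr add0r opprB.
  have xiE i : xi 0 i = - \sum_j z 0 j * Y j i by rewrite !mxE.
  move: xi xiE zB zR => xi xiE zB zR.
  have eB j : - \sum_i B i j * xi 0 i = x * z 0 j + z 0 j * (\sum_i (1 - B i j)).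
    have /(congr1 (fun M : 'rV_o => M 0 j)) := zB; rewrite mul_mx_diag !mxE => <-.
    by rewrite -sumrN; apply: eq_bigr => i _; rewrite !mxE mulrC mulNr.
  have eR i : xi 0 i * (\sum_j B i j) + (\sum_j z 0 j - \sum_j B i j * z 0 j) = x * xi 0 i.
    have /(congr1 (fun M : 'rV_c => M 0 i)) := zR.
    rewrite mul_mx_diag !mxE => <-; congr (_ + _).
    by rewrite -sumrB; apply: eq_bigr => j _; rewrite !mxE; ring.
  have sz : \sum_j z 0 j = - \sum_i xi 0 i.
    have h1 : - \sum_j \sum_i B i j * xi 0 i =
        x * (\sum_j z 0 j) + \sum_j z 0 j * (\sum_i (1 - B i j)).
      by rewrite -sumrN mulr_sumr -big_split; apply: eq_bigr => j _.
    have h2 : \sum_i xi 0 i * (\sum_j B i j) +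
        \sum_j z 0 j * (\sum_i (1 - B i j)) = x * \sum_i xi 0 i.
      rewrite mulr_sumr [RHS](eq_bigr _ (fun i _ => esym (eR i))) big_split; congr (_ + _).
      under [LHS]eq_bigr do rewrite mulr_sumr; rewrite exchange_big.
      by apply: eq_bigr => i _; rewrite -sumrB; apply: eq_bigr => j _; ring.
    have h3 : \sum_i xi 0 i * (\sum_j B i j) = \sum_j \sum_i B i j * xi 0 i.
      rewrite exchange_big; apply: eq_bigr => i _; rewrite mulr_sumr.
      by apply: eq_bigr => j _; rewrite mulrC.
    have : x * (\sum_j z 0 j + \sum_i xi 0 i) = 0 by lra.
    by move/eqP; rewrite mulf_eq0 gt_eqF //= addr_eq0 => /eqP.
  have hz : forall j, z 0 j = \sum_i Y j i * xi 0 i - (\sum_i xi 0 i) / x * defect Y j.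
    by apply: pev => // [i|j]; [have := eR i|have := eB j]; rewrite ?sz; lra.
  have zz : \sum_j z 0 j * z 0 j = - \sum_i xi 0 i * xi 0 i.
    have q1 : \sum_j z 0 j * (\sum_i Y j i * xi 0 i) = - \sum_i xi 0 i * xi 0 i.
      under eq_bigr do rewrite mulr_sumr; rewrite exchange_big -sumrN.
      apply: eq_bigr => i _; rewrite -mulNr [in - xi 0 i]xiE opprK mulr_suml.
      by apply: eq_bigr => j _; rewrite mulrA.
    have q2 : \sum_j z 0 j * defect Y j = 0.
      rewrite /defect; under eq_bigr do rewrite mulrBr mulr1 mulr_sumr.
      rewrite sumrB exchange_big sz -opprD -big_split big1 ?oppr0 // => i _ /=.
      by rewrite xiE addNr.
    rewrite [LHS](eq_bigr (fun j => z 0 j * (\sum_i Y j i * xi 0 i) -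
      (\sum_i xi 0 i) / x * (z 0 j * defect Y j))); last first.
      by move=> j _; rewrite [in X in _ * X = _]hz; ring.
    by rewrite sumrB q1 -mulr_sumr q2 mulr0 subr0.
  have zz0 : \sum_j z 0 j * z 0 j = 0.
    apply/le_anti/andP; split; last by apply: sumr_ge0 => j _; rewrite -expr2 sqr_ge0.
    by rewrite zz oppr_le0; apply: sumr_ge0 => j _; rewrite -expr2 sqr_ge0.
  case/negP: z0; apply/eqP/rowP => j; rewrite mxE.
  move/eqP: zz0; rewrite psumr_eq0 => [|l _]; last by rewrite -expr2 sqr_ge0.
  by move/allP/(_ j (mem_index_enum _)) => /=; rewrite mulf_eq0 orbb => /eqP.
have -> : \sum_(x <- E) Num.max x 0 = \tr A1.
  transitivity (\sum_(x <- 0 :: E) Num.max x 0).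
    by rewrite big_cons maxxx add0r.
  rewrite (perm_big _ pe) /= big_cons big_cat /=.
  rewrite [X in _ + (_ + X)]big1_seq ?addr0; last first.
    by move=> x /andP[_ xs]; apply/max_idPr/s2_le0.
  rewrite max_r ?oppr_le0 ?ler0n // add0r (char_poly_roots_trace e1).
  rewrite big_seq [RHS]big_seq; apply: eq_bigr => x xs.
  exact/max_idPl/s1_ge0.
rewrite /A1 linearB /= mxtrace_diag.
rewrite [X in X - _](eq_bigr (fun i => \sum_j B i j)); last by move=> i _; rewrite mxE.
rewrite gerBl /mxtrace; apply: sumr_ge0 => i _; rewrite mxE.
apply: sumr_ge0 => j _; rewrite mulr_ge0 // ltW //.
by have /andP[] := B01 i j.
Qed.
End SplitMatrix.

(** The limit [s -> 0]. It lets the weights of [split_bound_pos] reach 0 and 1, by first moving them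
    towards 1/2. *)
Lemma le_of_affine (R : realFieldType) (x y z : R) :
  (forall s, 0 < s < 1 -> (1 - s) * x + s * z <= y) -> x <= y.
Proof.
move=> h; rewrite leNgt; apply/negP => yx.
have [xz|zx] := lerP x z.
  have := h 2^-1; rewrite invr_gt0 ltr0n invf_lt1 ?ltr1n // => /(_ isT); lra.
have d0 : 0 < x - z + (x - y) by lra.
pose s := (x - y) / (x - z + (x - y)) / 2.
have s0 : 0 < s by rewrite !divr_gt0 ?ltr0n // subr_gt0.
have es : s * (x - z + (x - y)) = (x - y) / 2 by rewrite /s; field; rewrite gt_eqF.
have s1 : s < 1 by nra.
have := h s; rewrite s0 s1 => /(_ isT); nra.
Qed.

(** * The key estimate for a vertex set *)

Section SplitBound.
Variables (R : realType) (n : nat) (P : 'M[R]_n).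
Hypothesis pP : is_proj P.

(** For a projection this is |P (e_i - e_j)|^2. *)
Definition udist (P : 'M[R]_n) i j := P i i + P j j - 2 * P i j.

(** With the vertices of [C] listed first as the clique, the trace in [split_trace_pos] is the sum
    of [b i j * udist P i j] minus the right-hand side. *)
Lemma split_bound_pos (C : {set 'I_n}) (b : 'I_n -> 'I_n -> R) :
  (0 < #|C|)%N -> (forall i j, 0 < b i j < 1) ->
  \sum_(i in C) \sum_(j in ~: C) b i j * (udist P i j - 1) <=
  \sum_(i in C) \sum_(j in C) P i j + #|C|%:R * \sum_(j in ~: C) P j j.
Proof.
move=> C0 b01; set c := #|C|; set o := #|~: C|.
pose e1 (k : 'I_c) : 'I_n := enum_val k; pose e2 (k : 'I_o) : 'I_n := enum_val k.
pose h (x : 'I_(c + o)) := match split x with inl k => e1 k | inr k => e2 k end.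
have hl k : h (lshift o k) = e1 k by rewrite /h (unsplitK (inl k)).
have hr k : h (rshift c k) = e2 k by rewrite /h (unsplitK (inr k)).
have s1 (F : 'I_n -> R) : \sum_(i in C) F i = \sum_k F (e1 k) by rewrite big_enum_val.
have s2 (F : 'I_n -> R) : \sum_(i in ~: C) F i = \sum_k F (e2 k) by rewrite big_enum_val.
have sh (F : 'I_n -> R) : \sum_i F i = \sum_x F (h x).
  rewrite big_split_ord /= (bigID (mem C)) /= s1; congr (_ + _).
    by apply: eq_bigr => k _; rewrite hl.
  transitivity (\sum_(i in ~: C) F i); first by apply: eq_bigl => i; rewrite !inE.
  by rewrite s2; apply: eq_bigr => k _; rewrite hr.
pose P' : 'M[R]_(c + o) := \matrix_(x, y) P (h x) (h y).
have symP i j : P i j = P j i by rewrite -[in LHS](proj1 pP) mxE.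
have pP' : is_proj P'.
  split; apply/matrixP => x y; rewrite !mxE; first exact: symP.
  by rewrite -[in RHS](proj2 pP) mxE sh; apply: eq_bigr => z _; rewrite !mxE.
pose B : 'M[R]_(c, o) := \matrix_(k, l) b (e1 k) (e2 l).
have B01 i j : 0 < B i j < 1 by rewrite mxE.
have := split_trace_pos C0 B01 pP'.
rewrite /mxtrace big_split_ord /=.
have -> : \sum_(k < c) (P' *m split_mx B) (lshift o k) (lshift o k) =
    \sum_k \sum_l (P (e1 k) (e1 k) * B k l - P (e1 k) (e2 l) * B k l)
    - \sum_k \sum_l P (e1 k) (e1 l).
  rewrite -sumrB; apply: eq_bigr => k _.
  rewrite mxE big_split_ord /= sumrB -mulr_sumr.
  rewrite (eq_bigr (fun l => diag_mx (\row_i \sum_j B i j) k l * P (e1 k) (e1 l) -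
    P (e1 k) (e1 l))); last first.
    move=> l _; rewrite block_mxEul [P' _ _]mxE !hl; move: (B) => B'.
    rewrite !mxE [k == l]eq_sym; case: eqP => [->|_]; rewrite ?mulr1n ?mulr0n; ring.
  rewrite sumrB sum_diag_mx mxE.
  rewrite [X in _ + X](eq_bigr (fun l => - (P (e1 k) (e2 l) * B k l))) ?sumrN; last first.
    by move=> l _; rewrite block_mxEdl [P' _ _]mxE hl hr; move: (B) => B'; rewrite !mxE mulrN.
  by ring.
have -> : \sum_(k < o) (P' *m split_mx B) (rshift c k) (rshift c k) =
    \sum_k \sum_l (P (e2 l) (e2 l) * B k l - P (e1 k) (e2 l) * B k l)
    - c%:R * \sum_l P (e2 l) (e2 l).
  rewrite exchange_big mulr_sumr -sumrB; apply: eq_bigr => k _.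
  rewrite mxE big_split_ord /= sumrB -mulr_sumr.
  rewrite (eq_bigr (fun l => - (P (e1 l) (e2 k) * B l k))) ?sumrN; last first.
    by move=> l _; rewrite block_mxEur [P' _ _]mxE hl hr symP; move: (B) => B'; rewrite !mxE mulrN.
  rewrite [X in _ + X](eq_bigr (fun l =>
    diag_mx (\row_j \sum_i (1 - B i j)) k l * - P (e2 k) (e2 l))); last first.
    move=> l _; rewrite block_mxEdr [P' _ _]mxE !hr; move: (B) => B'.
    rewrite !mxE [k == l]eq_sym; case: eqP => [->|_]; rewrite ?mulr1n ?mulr0n; ring.
  rewrite sum_diag_mx mxE sumrB sumr_const card_ord; ring.
move=> main; rewrite s1 (eq_bigr (fun k =>
  \sum_l (B k l * (udist P (e1 k) (e2 l)) - B k l))); last first.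
  by move=> k _; rewrite s2; apply: eq_bigr => l _; rewrite mxE; ring.
rewrite [in X in _ <= X]s1 [in X in _ <= _ + X]s2.
have -> : \sum_k \sum_(j in C) P (e1 k) j = \sum_k \sum_l P (e1 k) (e1 l).
  by apply: eq_bigr => k _; rewrite s1.
have -> : \sum_k \sum_l (B k l * (udist P (e1 k) (e2 l)) - B k l) =
  \sum_k \sum_l (P (e1 k) (e1 k) * B k l - P (e1 k) (e2 l) * B k l) +
  \sum_k \sum_l (P (e2 l) (e2 l) * B k l - P (e1 k) (e2 l) * B k l) - \sum_k \sum_l B k l.
  rewrite -big_split -sumrB; apply: eq_bigr => k _.
  by rewrite -big_split -sumrB; apply: eq_bigr => l _; rewrite /udist /=; ring.
move: main; lra.
Qed.

Lemma split_bound (C : {set 'I_n}) (b : 'I_n -> 'I_n -> R) :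
  (forall i j, 0 <= b i j <= 1) ->
  \sum_(i in C) \sum_(j in ~: C) b i j * (udist P i j - 1) <=
  \sum_(i in C) \sum_(j in C) P i j + #|C|%:R * \sum_(j in ~: C) P j j.
Proof.
move=> b01; have [C0|C0] := posnP #|C|.
  by rewrite (cards0_eq C0) !big_set0 cards0 mul0r addr0.
apply: (@le_of_affine _ _ _
  (\sum_(i in C) \sum_(j in ~: C) (1 / 2) * (udist P i j - 1))) => s s01.
rewrite [X in X + _]mulr_sumr [X in _ + X <= _]mulr_sumr -big_split /=.
apply: le_trans (split_bound_pos (b := fun i j => (1 - s) * b i j + s * (1 / 2)) C0 _).
  apply: ler_sum => i _; rewrite !mulr_sumr -big_split /=.
  by apply: ler_sum => j _; lra.
move=> i j; have /andP[b0 b1] := b01 i j; have /andP[s0 s1] := s01.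
apply/andP; split; nra.
Qed.

End SplitBound.

(** * Fractional orientations *)

Section Tournament.
Local Open Scope classical_set_scope.
Local Open Scope ring_scope.
Variables (R : realType) (n : nat) (u : 'I_n -> 'I_n -> R) (k : R).
Hypothesis symu : forall i j, u i j = u j i.
Hypothesis u02 : forall i j, 0 <= u i j <= 2.

Definition fractional_orientation (w : 'I_n -> 'I_n -> R) :=
  [/\ forall i, w i i = 0, forall i j, i != j -> w i j + w j i = u i j
    & forall i j, i != j -> 0 <= w i j <= 1].

Definition imbalance (w : 'I_n -> 'I_n -> R) :=
  \sum_i (\sum_j w i j - k) * (\sum_j w i j - k).

(** An orientation is determined by its entries above the diagonal, which range over the box from
    max(0, u - 1) to min(1, u). A continuous function attains its minimum on this compact set. *)
Lemma least_imbalance : exists w, fractional_orientation w /\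
  forall w', fractional_orientation w' -> imbalance w <= imbalance w'.
Proof.
pose lo := \matrix_(i, j) Num.max 0 (u i j - 1).
pose hi := \matrix_(i, j) Num.min 1 (u i j).
pose W (v : 'rV[R]_(n * n)) (i j : 'I_n) :=
  if (i < j)%N then vec_mx v i j else if (j < i)%N then u i j - vec_mx v j i else 0.
pose A := [set v : 'rV[R]_(n * n) |
  forall l, [set` `[(mxvec lo) 0 l, (mxvec hi) 0 l]] (v ord0 l)].
have cA : compact A.
  apply: (@rV_compact R _ (fun l => [set` `[(mxvec lo) 0 l, (mxvec hi) 0 l]])) => l.
  exact: segment_compact.
have Aloc v : A v -> forall i j, lo i j <= vec_mx v i j <= hi i j.
  move=> Av i j; have := Av (mxvec_index i j); rewrite /= in_itv /= !mxvecE.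
  by rewrite [vec_mx v i j]mxE.
have WA v : A v -> fractional_orientation (W v).
  move=> /Aloc Av; split=> [i|i j ij|i j ij].
  - by rewrite /W ltnn.
  - rewrite /W; case: ltngtP => [lij|lij|/val_inj e].
    + by rewrite addrC subrK.
    + by rewrite subrK symu.
    by rewrite e eqxx in ij.
  have /andP[u0 u2] := u02 i j.
  have := Av i j; have := Av j i; rewrite !mxE (symu j i) /W.
  rewrite !le_min !ge_max => /andP[/andP[a1 a2] /andP[a3 a4]] /andP[/andP[b1 b2] /andP[b3 b4]].
  case: ltnP => h; first by apply/andP; split; rewrite !mxE.
  case: ltnP => h'; last by rewrite lexx ler01.
  by apply/andP; split; rewrite !mxE; lra.
have onto w : fractional_orientation w -> exists2 v, A v & W v =2 w.
  move=> [w0 w1 w2].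
  exists (mxvec (\matrix_(i, j) if (i < j)%N then w i j else lo i j)).
    move=> l; case/mxvec_indexP: l => i j; rewrite /= in_itv /= !mxvecE !mxE.
    have /andP[u0 u2] := u02 i j.
    case: ltnP => h.
      have ij : i != j by rewrite -val_eqE neq_ltn h.
      have := w1 _ _ ij; have /andP[] := w2 i j ij.
      have /andP[] : 0 <= w j i <= 1 by apply: w2; rewrite eq_sym.
      by move=> *; rewrite le_min ge_max; apply/andP; split; apply/andP; split; lra.
    by rewrite lexx /= le_min !ge_max; apply/andP; split; apply/andP; split; lra.
  move=> i j; rewrite /W mxvecK !mxE.
  case: ltngtP => h //; last by rewrite (val_inj h).
  have ij : i != j by rewrite -val_eqE neq_ltn h orbT.
  by rewrite -(w1 _ _ ij) addrK.
have contB (f g : 'rV[R]_(n * n) -> R) : continuous f -> continuous g ->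
    continuous (fun v => f v - g v).
  by move=> cf cg v; exact: cvgB (cf v) (cg v).
have contS (f : 'I_n -> 'rV[R]_(n * n) -> R) : (forall i, continuous (f i)) ->
    continuous (fun v => \sum_i f i v).
  by move=> cf; apply: (continuous_big add_continuous) => i _; exact: cf.
have cst (a : R) : continuous (fun _ : 'rV[R]_(n * n) => a).
  by move=> v; apply: (@cvg_cst _ _ _ (nbhs v)).
have Wcont i j : continuous (fun v => W v i j).
  rewrite /W; case: ltnP => _; last case: ltnP => _.
  - under eq_fun do rewrite mxE; exact: coord_continuous.
  - under eq_fun do rewrite mxE.
    by apply: contB; [exact: cst|exact: coord_continuous].
  exact: cst.
have Icont : continuous (fun v => imbalance (W v)).
  have rcont i : continuous (fun v => \sum_j W v i j - k).
    by apply: contB; [apply: contS => j; exact: Wcont|exact: cst].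
  by apply: contS => i v; exact: cvgM (rcont i v) (rcont i v).
have A0 : A !=set0.
  exists (mxvec lo) => l; case/mxvec_indexP: l => i j.
  have /andP[u0 u2] := u02 i j.
  rewrite /= in_itv /= lexx !mxvecE !mxE /=.
  by rewrite le_min !ge_max; apply/andP; split; apply/andP; split; lra.
have [v Av vmin] := compact_EVT_min A0 cA (continuous_subspaceT Icont).
exists (W v); split; first by apply: WA; exact: set_mem.
move=> w' /onto[v' Av' Wv'].
have -> : imbalance w' = imbalance (W v').
  by apply: eq_bigr => i _; rewrite (eq_bigr (W v' i)).
by apply: vmin; exact: mem_set.
Qed.

Lemma orientation_shift w i j : fractional_orientation w -> i != j ->
  forall s, 0 <= s -> s <= w i j -> s <= 1 - w j i ->
  let w' a b := w a b - s * ((a == i) && (b == j))%:R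
                      + s * ((a == j) && (b == i))%:R in
  fractional_orientation w'.
Proof.
move=> [w0 w1 w2] ij s s0 sij sji w'; split.
- move=> a; rewrite /w' w0; have [->|ai] := eqVneq a i.
    by rewrite (negPf ij) /= mulr0 subrr addr0.
  by rewrite andbF /= !mulr0 subrr addr0.
- move=> a b ab; rewrite /w' -(w1 _ _ ab) [(b == i) && _]andbC [(b == j) && _]andbC; ring.
move=> a b ab; have := w2 _ _ ab; rewrite /w'.
have := w2 i j ij; have : 0 <= w j i <= 1 by apply: w2; rewrite eq_sym.
have [ei|ai] := eqVneq a i; have [ej|bj] := eqVneq b j.
- rewrite ei ej (negPf ij) /= mulr0 mulr1 => *; lra.
- rewrite ei (negPf ij) /= !mulr0; lra.
- rewrite ej [j == i]eq_sym (negPf ij) andbF /= !mulr0; lra.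
have [ej'|aj] := eqVneq a j; have [ei'|bi] := eqVneq b i => /=;
  rewrite ?mulr0 ?mulr1 ?subr0 ?addr0 //.
rewrite ej' ei'; lra.
Qed.

(** Otherwise some weight could move from [w i j] to [w j i], bringing the two row sums closer
    together. *)
Lemma least_imbalance_min w i j : fractional_orientation w ->
  (forall w', fractional_orientation w' -> imbalance w <= imbalance w') ->
  \sum_l w j l < \sum_l w i l -> w i j <= Num.max 0 (u i j - 1).
Proof.
move=> fw wmin rij; rewrite leNgt gt_max; apply/negP => /andP[wij0 wiju].
have ij : i != j by apply/eqP => ij; rewrite ij ltxx in rij.
have [w0 w1 w2] := fw.
set ri := \sum_l w i l in rij; set rj := \sum_l w j l in rij.
have wji1 : 0 < 1 - w j i by have := w1 _ _ ij; lra.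
(* The first two bounds keep the shifted weights in [0, 1]; the third makes the change of the
   imbalance, - 2 s (ri - rj - s), negative. *)
pose s := Num.min (w i j) (Num.min (1 - w j i) ((ri - rj) / 2)).
have s0 : 0 < s by rewrite !lt_min wij0 wji1 /=; lra.
have : s <= s by []. rewrite {2}/s !le_min => /and3P[s1 s2 s3].
have fw' := orientation_shift fw ij (ltW s0) s1 s2; have := wmin _ fw'.
set w' := (fun a b => _).
have rw' a : \sum_b w' a b = \sum_b w a b - s * (a == i)%:R + s * (a == j)%:R.
  rewrite /w' big_split sumrB /= -!mulr_sumr.
  have e (x y : 'I_n) : \sum_b ((a == x) && (b == y))%:R = (a == x)%:R :> R.
    rewrite (bigD1 y) //= eqxx andbT big1 ?addr0 // => b /negPf ->.
    by rewrite andbF.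
  by rewrite !e.
have ji : j != i by rewrite eq_sym.
rewrite /imbalance (bigD1 i) // (bigD1 j) //= [leRHS](bigD1 i) // [X in _ <= _ + X](bigD1 j) //=.
rewrite [X in _ <= _ + (_ + X)](eq_bigr (fun l =>
  (\sum_b w l b - k) * (\sum_b w l b - k))); last first.
  by move=> l /andP[/negPf li /negPf lj]; rewrite rw' li lj !mulr0 subr0 addr0.
rewrite !rw' !eqxx (negPf ij) (negPf ji) !mulr0 !mulr1 -/ri -/rj.
nra.
Qed.

End Tournament.

(** * Orientations with constant row sums *)

Section Orientation.
Variables (R : realType) (n : nat).
Implicit Type P : 'M[R]_n.

Lemma proj_sym P : is_proj P -> forall i j, P i j = P j i.
Proof. by move=> [sP _] i j; rewrite -[in LHS]sP mxE. Qed.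

Lemma udist_sym P : is_proj P -> forall i j, udist P i j = udist P j i.
Proof. by move=> pP i j; rewrite /udist (proj_sym pP i j); ring. Qed.

Lemma udist_ge0 P : is_proj P -> forall i j, 0 <= udist P i j.
Proof.
move=> pP i j; have PE a b : P a b = \sum_l P a l * P b l.
  rewrite -[in LHS](proj2 pP) mxE; apply: eq_bigr => l _.
  by rewrite (proj_sym pP l b).
suff -> : udist P i j = \sum_l (P i l - P j l) ^+ 2.
  by apply: sumr_ge0 => l _; exact: sqr_ge0.
rewrite /udist !PE mulr_sumr -big_split -sumrB.
by apply: eq_bigr => l _ /=; ring.
Qed.

(** For distinct [i] and [j], the complementary projection has [udist] equal to 2 minus that of
    [P]. *)
Lemma udist_le2 P : is_proj P -> forall i j, udist P i j <= 2.
Proof.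
move=> pP i j; have := udist_ge0 (is_projC pP) i j; rewrite /udist !mxE !eqxx.
case: eqP => [->|_] /=; rewrite ?mulr1n ?mulr0n; lra.
Qed.

Lemma udist_id P i : udist P i i = 0.
Proof. by rewrite /udist; ring. Qed.

Lemma proj_row0 P i : P *m const_mx 1 = 0 :> 'cV_n -> \sum_j P i j = 0.
Proof.
move=> P1; have := congr1 (fun M : 'cV_n => M i 0) P1; rewrite !mxE => h.
by rewrite -[RHS]h; apply: eq_bigr => j _; rewrite mxE mulr1.
Qed.

Lemma orientation_sum P w : fractional_orientation (udist P) w ->
  forall i j, w i j + w j i = udist P i j.
Proof.
move=> [w0 w1 _] i j; have [->|ij] := eqVneq i j; last exact: w1.
by rewrite udist_id w0 addr0.
Qed.

Lemma orientation_exists P (k : R) : is_proj P -> P *m const_mx 1 = 0 :> 'cV_n ->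
  \tr P = k ->
  exists w, fractional_orientation (udist P) w /\ forall i, \sum_j w i j = k.
Proof.
move=> pP P1 trP; have symu := udist_sym pP.
have u02 i j : 0 <= udist P i j <= 2 by rewrite udist_ge0 ?udist_le2.
have [w [fw wmin]] := least_imbalance k symu u02.
exists w; split=> //; have wu := orientation_sum fw.
have pairs (S : {set 'I_n}) : \sum_(i in S) \sum_(j in S) w i j =
    #|S|%:R * \sum_(i in S) P i i - \sum_(i in S) \sum_(j in S) P i j.
  have h : \sum_(i in S) \sum_(j in S) w i j + \sum_(i in S) \sum_(j in S) w j i =
     \sum_(i in S) \sum_(j in S) (P i i + P j j - 2 * P i j).
    rewrite -big_split; apply: eq_bigr => i _; rewrite -big_split.
    by apply: eq_bigr => j _; rewrite /= wu.
  rewrite [X in _ + X]exchange_big /= in h.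
  have h2 : \sum_(i in S) \sum_(j in S) (P i i + P j j - 2 * P i j) =
     2 * (#|S|%:R * \sum_(i in S) P i i - \sum_(i in S) \sum_(j in S) P i j).
    rewrite (eq_bigr (fun i => #|S|%:R * P i i + \sum_(j in S) P j j -
      2 * \sum_(j in S) P i j)) => [|i _].
      rewrite sumrB big_split /= sumr_const -!mulr_sumr -[X in _ + X - _]mulr_natl; ring.
    by rewrite sumrB big_split /= sumr_const -mulr_sumr [in RHS]mulr_natl.
  lra.
pose full := [set: 'I_n].
have infull i : i \in full by rewrite !inE.
have cardfull : #|full| = n by rewrite cardsT card_ord.
have tot : \sum_i \sum_j w i j = n%:R * k.
  have := pairs full; rewrite cardfull -trP /mxtrace.
  rewrite [X in _ - X]big1 => [|i _]; last first.
    by rewrite -[RHS](proj_row0 i P1); apply: eq_bigl => j; rewrite infull.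
  rewrite subr0 => e.
  have sT (F : 'I_n -> R) : \sum_(i in full) F i = \sum_i F i.
    by apply: eq_bigl => i; rewrite infull.
  rewrite !sT in e; rewrite -e; apply: eq_bigr => i _; by rewrite sT.
have le_k i : \sum_j w i j <= k.
  have [m _ mmax] := @arg_maxP _ _ _ i xpredT (fun i => \sum_j w i j) isT.
  apply: le_trans (mmax i isT) _; rewrite leNgt; apply/negP => km.
  set rho := \sum_j w m j in mmax km.
  pose S := [set l | \sum_j w l j == rho].
  have mS : m \in S by rewrite inE.
  have S0 : 0 < #|S|%:R :> R by rewrite ltr0n; apply/card_gt0P; exists m.
  have sumS : \sum_(l in S) \sum_j w l j = #|S|%:R * rho.
    rewrite (eq_bigr (fun=> rho)) ?sumr_const ?mulr_natl // => l.
    by rewrite inE => /eqP.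
  (* Weights leaving the maximal rows are at their least value (u - 1)_+, which [split_bound]
     controls with the indicator of 1 <= u as weights. *)
  have bound : \sum_(l in S) \sum_(j in ~: S) w l j <=
      \sum_(l in S) \sum_(j in ~: S) (1 <= udist P l j)%R%:R * (udist P l j - 1).
    apply: ler_sum => l lS; apply: ler_sum => j jS.
    apply: le_trans (least_imbalance_min fw wmin _) _.
      move: lS jS; rewrite !inE => /eqP -> jS.
      by rewrite lt_neqAle jS; exact: (mmax j isT).
    by case: (lerP 1 (udist P l j)) => h; case: (lerP 0 (udist P l j - 1)) => h' /=; lra.
  have b01 l j : 0 <= ((1 <= udist P l j)%R%:R : R) <= 1.
    by rewrite ler0n lern1 leq_b1.
  have sb := split_bound pP S b01.
  have split_sum : \sum_(l in S) \sum_j w l j =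
      \sum_(l in S) \sum_(j in S) w l j + \sum_(l in S) \sum_(j in ~: S) w l j.
    rewrite -big_split; apply: eq_bigr => l _; rewrite (bigID (mem S)) /=.
    by congr (_ + _); apply: eq_bigl => j; rewrite !inE.
  have trS : \sum_(j in S) P j j + \sum_(j in ~: S) P j j = k.
    rewrite -trP /mxtrace [RHS](bigID (mem S)) /=; congr (_ + _).
    by apply: eq_bigl => j; rewrite !inE.
  have pS := pairs S.
  have : #|S|%:R * rho <= #|S|%:R * k.
    rewrite -sumS split_sum -trS pS mulrDr -addrA lerD2l addrC lerBlDr addrC.
    exact: le_trans bound sb.
  by rewrite ler_pM2l // leNgt km.
(* No row sum exceeds [k] and their total is n k, so all are equal to [k]. *)
have slack : \sum_i (k - \sum_j w i j) = 0.
  by rewrite sumrB sumr_const card_ord tot mulr_natl subrr.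
move/eqP: slack; rewrite psumr_eq0 => [/allP h i|i _]; last by rewrite subr_ge0.
by have /eqP := h i (mem_index_enum _); move/eqP; rewrite subr_eq0 => /eqP.
Qed.

End Orientation.

(** * Bounds of Brouwer and Grone-Merris type *)

Section EdgeSums.
Variables (R : realType) (n : nat) (P : 'M[R]_n) (k : R) (e : rel 'I_n).
Hypotheses (pP : is_proj P) (P1 : P *m const_mx 1 = 0 :> 'cV_n) (trP : \tr P = k).

(** Write w_ij = P_jj - P_ij + D_ij. As D is antisymmetric with zero row sums, and so are the row
    sums of P zero, the cross terms cancel and the sum is k^2 + k minus the sum of all D_ij^2. *)
Lemma orientation_trace_sqr w : (forall i j, w i j + w j i = udist P i j) ->
  (forall i, \sum_j w i j = k) -> \sum_i \sum_j w i j * w j i <= k ^+ 2 + k.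
Proof.
move=> wu wk; have symP := proj_sym pP.
pose D i j := w i j - P j j + P i j.
have DD i j : D j i = - D i j by have := wu i j; rewrite /udist /D (symP j i); lra.
have D1 i : \sum_j D i j = 0.
  by rewrite big_split sumrB /= wk (proj_row0 _ P1) -/(\tr P) trP subrr addr0.
have aD : \sum_i \sum_j P i i * D i j = 0.
  by rewrite big1 // => i _; rewrite -mulr_sumr D1 mulr0.
have PD : \sum_i \sum_j P i j * D i j = 0.
  have : \sum_i \sum_j P i j * D i j = - \sum_i \sum_j P i j * D i j.
    rewrite [LHS]exchange_big -sumrN; apply: eq_bigr => i _; rewrite -sumrN.
    by apply: eq_bigr => j _; rewrite DD symP mulrN.
  lra.
have aP : \sum_i \sum_j P i i * P i j = 0.
  by rewrite big1 // => i _; rewrite -mulr_sumr (proj_row0 _ P1) mulr0.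
have PP : \sum_i \sum_j P i j * P i j = k.
  rewrite -trP -[in RHS](proj2 pP); apply: eq_bigr => i _; rewrite mxE.
  by apply: eq_bigr => j _; rewrite (symP j i).
have aa : \sum_i \sum_j P i i * P j j = k ^+ 2.
  by rewrite -trP /mxtrace expr2 mulr_suml; apply: eq_bigr => i _; rewrite mulr_sumr.
have aD' : \sum_i \sum_j P j j * D j i = 0 by rewrite exchange_big.
have PD' : \sum_i \sum_j P j i * D j i = 0 by rewrite exchange_big.
have aP' : \sum_i \sum_j P j j * P j i = 0 by rewrite exchange_big.
have -> : \sum_i \sum_j w i j * w j i =
    \sum_i \sum_j P i i * P j j + \sum_i \sum_j P i j * P i j
    - \sum_i \sum_j P i i * P i j - \sum_i \sum_j P j j * P j i
    + \sum_i \sum_j P i i * D i j + \sum_i \sum_j P j j * D j i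
    - \sum_i \sum_j P i j * D i j - \sum_i \sum_j P j i * D j i
    - \sum_i \sum_j D i j * D i j.
  rewrite -?(big_split, sumrB); apply: eq_bigr => i _.
  rewrite -?(big_split, sumrB); apply: eq_bigr => j _ /=.
  have wji : w j i = P i i + P j j - 2 * P i j - w i j.
    by have := wu i j; rewrite /udist; lra.
  by rewrite /D (symP j i) wji; ring.
have : 0 <= \sum_i \sum_j D i j * D i j.
  by apply: sumr_ge0 => i _; apply: sumr_ge0 => j _; rewrite -expr2 sqr_ge0.
lra.
Qed.

(** On an edge, u_ij - 1 = w_ij + w_ji - 1 <= w_ij w_ji because (1 - w_ij) (1 - w_ji) >= 0;
    elsewhere 0 <= w_ij w_ji. *)
Lemma brouwer_bound :
  \sum_i \sum_j (e i j)%:R * (udist P i j - 1) <= k ^+ 2 + k.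
Proof.
have [w [fw wk]] := orientation_exists pP P1 trP.
have wu := orientation_sum fw; have [w0 w1 w2] := fw.
apply: le_trans (orientation_trace_sqr wu wk).
apply: ler_sum => i _; apply: ler_sum => j _; rewrite -wu.
have [->|ij] := eqVneq i j; first by rewrite !w0; case: (e _ _) => /=; lra.
have /andP[a0 a1] := w2 i j ij.
have /andP[b0 b1] : 0 <= w j i <= 1 by apply: w2; rewrite eq_sym.
by case: (e i j) => /=; nra.
Qed.

(** The weights of a row on its neighbours sum to at most the degree, each being at most 1, and to
    at most the whole row sum [k]. *)
Lemma grone_merris_bound : symmetric e ->
  \sum_i \sum_j (e i j)%:R * udist P i j <=
  2 * \sum_i Num.min (\sum_j (e i j)%:R) k.
Proof.
move=> syme; have [w [fw wk]] := orientation_exists pP P1 trP.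
have wu := orientation_sum fw; have [w0 w1 w2] := fw.
have w01 i j : 0 <= w i j <= 1.
  by have [->|/w2//] := eqVneq i j; rewrite w0 lexx ler01.
have -> : \sum_i \sum_j (e i j)%:R * udist P i j =
    2 * \sum_i \sum_j (e i j)%:R * w i j.
  have sw : \sum_i \sum_j (e i j)%:R * w i j = \sum_i \sum_j (e i j)%:R * w j i.
    rewrite exchange_big; apply: eq_bigr => i _; apply: eq_bigr => j _.
    by rewrite syme.
  rewrite mulr_natl mulr2n {2}sw -big_split; apply: eq_bigr => i _.
  by rewrite -big_split; apply: eq_bigr => j _; rewrite -wu /= mulrDr.
rewrite ler_pM2l ?ltr0n //; apply: ler_sum => i _; rewrite le_min.
apply/andP; split.
  apply: ler_sum => j _; have /andP[a0 a1] := w01 i j.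
  by case: (e i j) => /=; lra.
rewrite -(wk i); apply: ler_sum => j _; have /andP[a0 a1] := w01 i j.
by case: (e i j) => /=; lra.
Qed.

End EdgeSums.

(** * Laplacians *)

Section RelationLaplacian.
Variables (R : realType) (n : nat) (e : rel 'I_n).
Hypotheses (syme : symmetric e) (irre : irreflexive e).

Definition rdeg i : R := \sum_j (e i j)%:R.

Definition rel_laplacian : 'M[R]_n := \matrix_(i, j) (rdeg i *+ (i == j) - (e i j)%:R).

Local Notation L := rel_laplacian.

Lemma rdeg_ge0 i : 0 <= rdeg i.
Proof. by apply: sumr_ge0 => j _; rewrite ler0n. Qed.

Lemma rel_laplacian_sym : L^T = L.
Proof.
apply/matrixP => i j; rewrite !mxE syme eq_sym; congr (_ - _).
by case: eqP => [->|].
Qed.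

Lemma rel_laplacian_diag i : L i i = rdeg i.
Proof. by rewrite mxE eqxx irre subr0 mulr1n. Qed.

Lemma sum_rel_laplacian i (v : 'I_n -> R) :
  \sum_j L i j * v j = \sum_j (e i j)%:R * (v i - v j).
Proof.
under eq_bigr do rewrite mxE mulrBl.
rewrite sumrB (bigD1 i) //= eqxx mulr1n big1 ?addr0 => [|j ji]; last first.
  by rewrite eq_sym (negPf ji) mulr0n mul0r.
by rewrite /rdeg mulr_suml -sumrB; apply: eq_bigr => j _; rewrite mulrBr.
Qed.

Lemma rel_laplacian1 : L *m const_mx 1 = 0 :> 'cV_n.
Proof.
apply/colP => i; rewrite mxE (eq_bigr (fun j => L i j * 1)) => [|j _]; last first.
  by rewrite [X in _ * X]mxE.
by rewrite sum_rel_laplacian mxE big1 // => j _; rewrite subrr mulr0.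
Qed.

Lemma rel_laplacian_psd (v : 'I_n -> R) : 0 <= \sum_i \sum_j v i * L i j * v j.
Proof.
have E : \sum_i \sum_j v i * L i j * v j = \sum_i \sum_j (e i j)%:R * (v i * (v i - v j)).
  apply: eq_bigr => i _; under eq_bigr do rewrite -mulrA.
  rewrite -mulr_sumr sum_rel_laplacian mulr_sumr.
  by apply: eq_bigr => j _; rewrite mulrCA.
have E' : \sum_i \sum_j v i * L i j * v j = \sum_i \sum_j (e i j)%:R * (v j * (v j - v i)).
  rewrite E exchange_big; apply: eq_bigr => i _; apply: eq_bigr => j _.
  by rewrite syme.
have : \sum_i \sum_j v i * L i j * v j + \sum_i \sum_j v i * L i j * v j =
    \sum_i \sum_j (e i j)%:R * (v i - v j) ^+ 2.
  rewrite {1}E E' -big_split; apply: eq_bigr => i _.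
  by rewrite -big_split; apply: eq_bigr => j _ /=; ring.
have : 0 <= \sum_i \sum_j (e i j)%:R * (v i - v j) ^+ 2.
  by apply: sumr_ge0 => i _; apply: sumr_ge0 => j _; rewrite mulr_ge0 ?ler0n ?sqr_ge0.
lra.
Qed.

Lemma sum_sqr_rel_laplacian i : \sum_j L i j * L i j = rdeg i ^+ 2 + rdeg i.
Proof.
rewrite sum_rel_laplacian rel_laplacian_diag.
rewrite (eq_bigr (fun j => (e i j)%:R * rdeg i + (e i j)%:R)) => [|j _].
  by rewrite big_split -mulr_suml /= -/(rdeg i) expr2.
rewrite [L i j]mxE; case: eqVneq => [<-|_]; first by rewrite irre !mul0r add0r.
by case: (e i j) => /=; rewrite mulr0n; ring.
Qed.

Lemma trace_mul_rel_laplacian (P : 'M[R]_n) : P^T = P ->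
  2 * \tr (P *m L) = \sum_i \sum_j (e i j)%:R * udist P i j.
Proof.
move=> sP; have symP i j : P i j = P j i by rewrite -[in LHS]sP mxE.
have E : \tr (P *m L) = \sum_i \sum_j (e i j)%:R * (P i i - P i j).
  rewrite /mxtrace; apply: eq_bigr => i _; rewrite mxE.
  rewrite -(sum_rel_laplacian i (fun j => P i j)).
  by apply: eq_bigr => j _; rewrite -[in L j i]rel_laplacian_sym [L^T j i]mxE mulrC.
have E' : \tr (P *m L) = \sum_i \sum_j (e i j)%:R * (P j j - P i j).
  rewrite E exchange_big; apply: eq_bigr => i _; apply: eq_bigr => j _.
  by rewrite syme symP.
rewrite mulr_natl mulr2n {1}E E' -big_split; apply: eq_bigr => i _.
by rewrite -big_split; apply: eq_bigr => j _; rewrite /udist /=; ring.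
Qed.

(** * The second moment bound *)

Section SecondMoment.
Variable P : 'M[R]_n.
Hypotheses (pP : is_proj P) (PL : P *m L = L *m P).

(* With [p = P e_i], [q = e_i - p] and [l = L e_i], the difference of the two
   sides is [K |p - s l|^2 + (1 - 2 K s) q^T L q]. *)
Lemma second_moment_vertex i (K s : R) : 0 <= K -> 0 <= s -> 2 * K * s <= 1 ->
  (P *m L) i i - K * P i i <=
  rdeg i - 2 * K * rdeg i * s + K * (rdeg i ^+ 2 + rdeg i) * s ^+ 2.
Proof.
move=> K0 s0 Ks; have symP := proj_sym pP.
have symL a b : L a b = L b a by rewrite -[in LHS]rel_laplacian_sym mxE.
set x := (P *m L) i i.
have sqP : \sum_j P i j * P i j = P i i.
  rewrite -[in RHS](proj2 pP) mxE; apply: eq_bigr => j _; by rewrite (symP j i).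
have xE : \sum_j P i j * L i j = x.
  by rewrite /x mxE; apply: eq_bigr => j _; rewrite (symL j i).
have norm_ge0 : 0 <= P i i - 2 * s * x + s ^+ 2 * (rdeg i ^+ 2 + rdeg i).
  rewrite -sqP -xE -sum_sqr_rel_laplacian !mulr_sumr -sumrB -big_split.
  apply: sumr_ge0 => j _ /=.
  have -> : P i j * P i j - 2 * s * (P i j * L i j) + s ^+ 2 * (L i j * L i j) =
    (P i j - s * L i j) ^+ 2 by ring.
  exact: sqr_ge0.
(* This is q^T L q >= 0 for q = (1 - P) e_i, since (1 - P) L (1 - P) = L - P L. *)
have xd : x <= rdeg i.
  have quad (Q : 'M[R]_n) : is_proj Q -> 0 <= (Q *m L *m Q) i i.
    move=> pQ; have := rel_laplacian_psd (fun j => Q i j).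
    rewrite exchange_big [X in _ -> 0 <= X]mxE (eq_bigr (fun j => (Q *m L) i j * Q j i)) // => j _.
    by rewrite [(Q *m L) i j]mxE mulr_suml; apply: eq_bigr => a _; rewrite (proj_sym pQ j i).
  have := quad _ (is_projC pP).
  rewrite mulmxBr mulmx1 !mulmxBl mul1mx -mulmxA -PL mulmxA (proj2 pP).
  by rewrite subrr subr0 [X in 0 <= X]mxE [X in _ + X]mxE rel_laplacian_diag subr_ge0.
nra.
Qed.

(** Sum [second_moment_vertex] with K = (k + 1) / 2. The optimal s is 1 / (deg + 1), which is
    admissible when deg >= k; below that the largest admissible value 1 / (k + 1) is taken. *)
Lemma second_moment (k : nat) (phi : 'I_n -> R) : \tr P = k%:R ->
  (forall i, rdeg i <= k%:R -> rdeg i * (rdeg i + 1) / (2 * (k%:R + 1)) <= phi i) ->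
  (forall i, k%:R <= rdeg i -> rdeg i - k%:R / 2 <= phi i) ->
  \tr (P *m L) <= k%:R * (k%:R + 1) / 2 + \sum_i phi i.
Proof.
move=> trP lo hi; set K : R := (k%:R + 1) / 2.
have k0 : 0 <= k%:R :> R by exact: ler0n.
have K0 : 0 < K by rewrite /K; lra.
suff h i : (P *m L) i i - K * P i i <= phi i.
  have : \sum_i ((P *m L) i i - K * P i i) <= \sum_i phi i by apply: ler_sum.
  rewrite sumrB -mulr_sumr -!/(\tr _) trP /K; lra.
have d0 := rdeg_ge0 i; have [dk|kd] := lerP (rdeg i) k%:R.
  apply: le_trans (lo i dk).
  have s0 : 0 <= (k%:R + 1)^-1 :> R by rewrite invr_ge0; lra.
  apply: le_trans (second_moment_vertex i (ltW K0) s0 _) _.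
    have -> : 2 * K = k%:R + 1 by rewrite /K; lra.
    by rewrite mulfV // gt_eqF //; lra.
  rewrite le_eqVlt; apply/orP; left; apply/eqP; rewrite /K; field; lra.
apply: le_trans (hi i (ltW kd)).
have s0 : 0 <= (rdeg i + 1)^-1 by rewrite invr_ge0; lra.
apply: le_trans (second_moment_vertex i (ltW K0) s0 _) _.
  by rewrite ler_pdivrMr /K; lra.
have -> : rdeg i - 2 * K * rdeg i / (rdeg i + 1) +
    K * (rdeg i ^+ 2 + rdeg i) * (rdeg i + 1)^-1 ^+ 2 = rdeg i - K * rdeg i / (rdeg i + 1).
  by rewrite /K; field; lra.
by rewrite lerD2l lerN2 ler_pdivlMr /K; lra.
Qed.

End SecondMoment.
End RelationLaplacian.

(** * Numerical inequalities *)

Section Numeric.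
Variable R : realFieldType.

(** This is n (tr(P L) - k d) for the pineapple graph with clique size k + 1 and the projection
    [pineapple_proj] of rank k. *)
Definition pineapple_value (n k : R) := k * (k + 1) * (n - k) + (n - k - 1) * (n - 2 * k).

Lemma two_thirds (n : nat) : exists q a : nat,
  [/\ ((2 * n) %/ 3)%N = a & [\/ n = (3 * q)%N /\ a = (2 * q)%N,
     n = (3 * q + 1)%N /\ a = (2 * q)%N | n = (3 * q + 2)%N /\ a = (2 * q + 1)%N]].
Proof.
exists (n %/ 3)%N, ((2 * n) %/ 3)%N; split=> //.
have : (n %% 3 < 3)%N by rewrite ltn_mod.
have := divn_eq n 3; case: (n %% 3)%N => [|[|[|//]]] e _.
- by constructor 1; lia.
- by constructor 2; lia.
by constructor 3; lia.
Qed.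

(** The difference of two values has the factor [c - b]. Two distinct integers differ by at least 1,
    which fixes the sign of the cofactor in each residue class of [n] modulo 3. *)
Lemma pineapple_value_max (n k : nat) : (1 < n)%N -> (n <= 2 * k)%N -> (k < n)%N ->
  pineapple_value n%:R k%:R <= pineapple_value n%:R ((2 * n) %/ 3)%N%:R.
Proof.
move=> n1 nk kn; have [q [a [-> cases]]] := two_thirds n.
have fact (b c m : R) : pineapple_value m c - pineapple_value m b =
    (c - b) * (- (c ^+ 2 + c * b + b ^+ 2) + (m + 1) * (c + b) + 2 - 2 * m).
  by rewrite /pineapple_value; ring.
rewrite -subr_ge0 fact.
have q0 : 0 <= q%:R :> R by [].
have nkR : n%:R <= 2 * k%:R :> R by rewrite -natrM ler_nat.
have knR : k%:R + 1 <= n%:R :> R by rewrite natr1 ler_nat.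
have n1R : 2 <= n%:R :> R by rewrite ler_nat.
have [ka|ak|->] := ltngtP k a; last by rewrite subrr mul0r.
  have kaR : k%:R + 1 <= a%:R :> R by rewrite natr1 ler_nat.
  apply: mulr_ge0; first lra.
  case: cases => -[nE aE]; move: nkR knR n1R kaR; rewrite nE aE !natrD ?natrM;
    move: q%:R k%:R q0 => Q K q0 *; nra.
have kaR : a%:R + 1 <= k%:R :> R by rewrite natr1 ler_nat.
rewrite mulr_le0 //; first lra.
case: cases => -[nE aE]; move: nkR knR n1R kaR; rewrite nE aE !natrD ?natrM;
    move: q%:R k%:R q0 => Q K q0 *; nra.
Qed.

(** To leading order both sides reach 4 n^3 / 27, the left one near k = n / 3. The certificates in
    the proof therefore use squares centred near K = Q, where Q is n / 3 rounded down. *)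
Lemma pineapple_value_small (n k : nat) : (1 < n)%N -> (2 * k <= n)%N ->
  k%:R * ((n%:R - k%:R) ^+ 2 + k%:R) <= pineapple_value n%:R ((2 * n) %/ 3)%N%:R :> R.
Proof.
move=> n1 kn; have [q [a [-> cases]]] := two_thirds n.
have q0 : 0 <= q%:R :> R by [].
have k0 : 0 <= k%:R :> R by [].
have knR : 2 * k%:R <= n%:R :> R by rewrite -natrM ler_nat.
have n1R : 2 <= n%:R :> R by rewrite ler_nat.
rewrite /pineapple_value.
case: cases => -[nE aE]; move: knR n1R; rewrite nE aE !natrD ?natrM.
- have q1 : 1 <= q%:R :> R by rewrite ler1n; lia.
  move: q%:R k%:R q0 k0 q1 => Q K Q0 K0 Q1 h _.
  have h1 : 0 <= (Q / 2 - (K - Q)) * (K - Q) ^+ 2 by rewrite mulr_ge0 ?sqr_ge0 //; lra.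
  have h2 : 0 <= (Q - 1) * (K - Q) ^+ 2 by rewrite mulr_ge0 ?sqr_ge0 //; lra.
  have h3 : 0 <= Q * (K - Q - 2 / 3) ^+ 2 by rewrite mulr_ge0 ?sqr_ge0.
  lra.
- have q1 : 1 <= q%:R :> R by rewrite ler1n; lia.
  move: q%:R k%:R q0 k0 q1 => Q K Q0 K0 Q1 h _.
  have h1 : 0 <= ((Q + 1) / 2 - (K - Q)) * (1 - (K - Q)) ^+ 2.
    by rewrite mulr_ge0 ?sqr_ge0 //; lra.
  have h2 : 0 <= (Q - 1) * (K - Q - 3 / 5) ^+ 2 by rewrite mulr_ge0 ?sqr_ge0 //; lra.
  have h3 : 0 <= (1 - (K - Q)) ^+ 2 by exact: sqr_ge0.
  lra.
move: q%:R k%:R q0 k0 => Q K Q0 K0 h _.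
have h1 : 0 <= (Q / 2 + 1 - (K - Q)) * ((1 - (K - Q)) ^+ 2 + 1).
  rewrite mulr_ge0 //; first lra.
  by rewrite addr_ge0 ?sqr_ge0.
have h2 : 0 <= Q * (K - Q - 1) ^+ 2 by rewrite mulr_ge0 ?sqr_ge0.
lra.
Qed.

Lemma convex_quadratic_le0 (a b c x y z : R) : 0 <= a -> x <= y -> y <= z ->
  a * x ^+ 2 + b * x + c <= 0 -> a * z ^+ 2 + b * z + c <= 0 ->
  a * y ^+ 2 + b * y + c <= 0.
Proof.
move=> a0; rewrite le_eqVlt => /predU1P[<- //|xy].
move=> yz qx qz; have xz : 0 < z - x by lra.
rewrite -(pmulr_rle0 _ xz).
have -> : (z - x) * (a * y ^+ 2 + b * y + c) = (z - y) * (a * x ^+ 2 + b * x + c)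
  + (y - x) * (a * z ^+ 2 + b * z + c) - a * (z - x) * ((y - x) * (z - y)) by ring.
have h1 : (z - y) * (a * x ^+ 2 + b * x + c) <= 0 by rewrite mulr_ge0_le0 //; lra.
have h2 : (y - x) * (a * z ^+ 2 + b * z + c) <= 0 by rewrite mulr_ge0_le0 //; lra.
have h3 : 0 <= a * (z - x) * ((y - x) * (z - y)).
  by rewrite !mulr_ge0 //; lra.
lra.
Qed.

(* The function [x * (M - x)] on [0, M], extended with period [M], is
   subadditive. *)
Lemma sum_periodic_concave (I : Type) (s : seq I) (x : I -> R) (M : R) :
  0 <= M -> (forall i, 0 <= x i <= M) -> exists (h : nat) (rho : R),
  [/\ 0 <= rho <= M, \sum_(i <- s) x i = M * h%:R + rho
    & rho * (M - rho) <= \sum_(i <- s) x i * (M - x i)].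
Proof.
move=> M0 xM; elim: s => [|i s [h [rho [/andP[r0 rM] e1 e2]]]].
  by exists 0%N, 0; rewrite !big_nil M0 lexx mulr0 addr0 mul0r.
have /andP[x0 x1] := xM i; rewrite !big_cons e1.
have [small|large] := lerP (x i + rho) M.
  exists h, (x i + rho); split; [by rewrite small addr_ge0|by ring|].
  have := mulr_ge0 x0 r0; lra.
exists h.+1, (x i + rho - M); split.
- by apply/andP; split; lra.
- by rewrite -addn1 natrD; ring.
have : 0 <= (M - x i) * (M - rho) by rewrite mulr_ge0 // subr_ge0.
lra.
Qed.

(** The remainder of the sum modulo [M] is [M - g], except that 0 and [M] may be exchanged, and
    there the left-hand side is 0. *)
Lemma sum_concave_ge (I : finType) (x : I -> R) (M g : R) (h : nat) :
  (forall i, 0 <= x i <= M) -> 0 <= g <= M -> \sum_i x i = M * h.+1%:R - g ->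
  g * (M - g) <= \sum_i x i * (M - x i).
Proof.
move=> xM /andP[g0 gM] e; have M0 := le_trans g0 gM.
have [h' [rho [/andP[r0 rM] e1 e2]]] := sum_periodic_concave (index_enum I) M0 xM.
apply: le_trans e2; move: e1; rewrite e -natr1.
have [hh|hh|->] := ltngtP h h'.
- have : h%:R + 1 <= h'%:R :> R by rewrite natr1 ler_nat.
  move: h%:R h'%:R => a b ab e1.
  have ? : M * (b - a - 1) >= 0 by rewrite mulr_ge0 //; lra.
  have -> : g = 0 by lra.
  by rewrite mul0r mulr_ge0 // subr_ge0.
- have : h'%:R + 1 <= h%:R :> R by rewrite natr1 ler_nat.
  move: h%:R h'%:R => a b ab e1.
  have ? : M * (a - b - 1) >= 0 by rewrite mulr_ge0 //; lra.
  have -> : g = M by lra.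
  by rewrite subrr mulr0 mulr_ge0 // subr_ge0.
move: h'%:R => a e1; have -> : g = M - rho by lra.
lra.
Qed.

(** Put N = a + 1 and n = a + b + 1. Replacing [g] by its bound b D / N in the last inequality
    forces a convex quadratic in [D] to be positive, but it is nonpositive at both ends of the range
    [2 N / n, a] of [D]. *)
Lemma balanced_absurd (a b D g : R) : 0 <= a -> a + 1 <= b -> b <= 2 * a + 2 ->
  D <= a -> 2 * (a + 1) <= (a + b + 1) * D -> 0 <= g -> (a + 1) * g < b * D ->
  2 * (b + 1) * D <= 2 * a + g * (g + 1) -> False.
Proof.
move=> a0 ab ba Da nD g0 gD main.
have n0 : 0 < a + b + 1 by lra.
have [N NE] : exists N, N = a + 1 by exists (a + 1).
have [n nE] : exists n, n = a + b + 1 by exists (a + b + 1).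
rewrite -nE -NE in nD n0 gD.
have N0 : 0 < N by lra.
have Dge : 2 * N / n <= D by rewrite ler_pdivrMr // [D * n]mulrC.
have D0 : 0 < D by rewrite -(pmulr_rgt0 _ n0); lra.
have h : 0 < b ^+ 2 * D ^+ 2 + (N * b - 2 * (b + 1) * N ^+ 2) * D + 2 * a * N ^+ 2.
  have Ng0 : 0 <= N * g by rewrite mulr_ge0 // ltW.
  have sq : (N * g) ^+ 2 <= (b * D) ^+ 2.
    by rewrite lerXn2r ?nnegrE // ltW // (le_lt_trans Ng0).
  have h1 : N ^+ 2 * (2 * (b + 1) * D) <= N ^+ 2 * (2 * a + g * (g + 1)).
    by rewrite ler_pM2l // exprn_gt0.
  have h2 : N * (N * g) < N * (b * D) by rewrite ltr_pM2l.
  have e1 : N ^+ 2 * (2 * a + g * (g + 1)) = 2 * a * N ^+ 2 + (N * g) ^+ 2 + N * (N * g) by ring.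
  have e2 : b ^+ 2 * D ^+ 2 + (N * b - 2 * (b + 1) * N ^+ 2) * D + 2 * a * N ^+ 2 =
    2 * a * N ^+ 2 + (b * D) ^+ 2 + N * (b * D) - N ^+ 2 * (2 * (b + 1) * D) by ring.
  rewrite e2 subr_gt0; apply: le_lt_trans h1 _; rewrite e1.
  by apply: ler_ltD; rewrite ?lerD2l.
suff : b ^+ 2 * D ^+ 2 + (N * b - 2 * (b + 1) * N ^+ 2) * D + 2 * a * N ^+ 2 <= 0.
  by rewrite leNgt h.
apply: (convex_quadratic_le0 _ Dge Da); first exact: sqr_ge0.
  rewrite -(pmulr_rle0 _ (exprn_gt0 2 n0)).
  have -> : n ^+ 2 * (b ^+ 2 * (2 * N / n) ^+ 2 +
      (N * b - 2 * (b + 1) * N ^+ 2) * (2 * N / n) + 2 * a * N ^+ 2) =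
    N ^+ 2 * (4 * b ^+ 2 + 2 * b * n - 4 * (b + 1) * N * n + 2 * a * n ^+ 2).
    by field; rewrite gt_eqF.
  rewrite pmulr_rle0 ?exprn_gt0 //.
  have h1 : 0 <= a * (n * (2 * b - n)).
    by rewrite !mulr_ge0 //; [exact: ltW|lra].
  have h2 : 0 <= b * (2 * a + 2 - b) by rewrite mulr_ge0 //; lra.
  have h3 : 0 <= a * b by rewrite mulr_ge0 //; lra.
  clear main h Dge nD gD; subst N n; nra.
have -> : b ^+ 2 * a ^+ 2 + (N * b - 2 * (b + 1) * N ^+ 2) * a +
  2 * a * N ^+ 2 = (a * b) * (b * a + N - 2 * N ^+ 2) by ring.
rewrite mulr_ge0_le0 ?mulr_ge0 //; first by lra.
have : 0 <= a * (2 * a + 2 - b) by rewrite mulr_ge0 //; lra.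
subst N; lra.
Qed.

(* Used with [o = n - 1 - k], [p = k (k + 1) / 2 + o - m],
   [D = o - (2 m - tr (P L))] and [g = 2 p + sum_i (deg_i - k)_+ - o]; [sl] is
   the gain of [k* = floor(2 n / 3)] over [k]. *)
Lemma connected_numeric (o k : nat) (p D g sl : R) :
  (o < k)%N -> 1 <= p -> D <= o%:R -> g <= 2 * p - D -> 0 <= sl ->
  (g < k%:R -> g <= k%:R - 1) ->
  (g < 0 -> 2 * (k%:R + 1) * D <= 2 * o%:R) ->
  (0 <= g -> g <= k%:R - 1 -> 2 * (k%:R + 1) * D <= 2 * o%:R + g * (g + 1)) ->
  ((2 * o + 3 <= k)%N ->
    k%:R * (k%:R - 2 * o%:R - 4) + 3 * (o%:R + 1) <= (o + k + 1)%:R * sl) ->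
  D <= 2 * (o%:R + 1) / (o + k + 1)%:R * p + sl.
Proof.
move=> ok p1 Do gp sl0 gint gneg gpos slk; rewrite leNgt; apply/negP => contra.
have o0 : 0 <= o%:R :> R by [].
have okR : o%:R + 1 <= k%:R :> R by rewrite natr1 ler_nat.
move: slk contra; rewrite !natrD => slk contra.
set n : R := o%:R + k%:R + 1 in slk contra.
have n0 : 0 < n by rewrite /n; lra.
have {}contra : 2 * (o%:R + 1) * p + n * sl < n * D.
  move: contra; rewrite -(ltr_pM2l n0) => h; apply: le_lt_trans h.
  rewrite le_eqVlt; apply/orP; left; apply/eqP; field; lra.
have nsl : 0 <= n * sl by rewrite mulr_ge0 // ltW.
have x0 : 2 * (o%:R + 1) <= n * D by nra.
have Dge : 2 * (o%:R + 1) / n <= D by rewrite ler_pdivrMr // [D * n]mulrC.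
have D0 : 0 < D by rewrite -(pmulr_rgt0 _ n0); lra.
have gG : (o%:R + 1) * g < k%:R * D - n * sl.
  have : (o%:R + 1) * g <= (o%:R + 1) * (2 * p - D) by rewrite ler_wpM2l //; lra.
  rewrite /n in contra *; lra.
have gk : g < k%:R by nra.
have [gn|g0] := ltrP g 0.
  have := gneg gn; rewrite /n in x0; nra.
have {gpos gneg gint} main := gpos g0 (gint gk).
(* For k >= 2 o + 3 the gain [sl] improves [gG] to g < 2 D, and [main] contradicts a convex
   quadratic in [D]. For smaller [k], [balanced_absurd] applies without the gain. *)
have [kbig|ksmall] := leqP (2 * o + 3) k.
  have {}slk := slk kbig.
  have kbigR : 2 * o%:R + 3 <= k%:R :> R by rewrite -natrM -natrD ler_nat.
  have slD : (k%:R - 2 * (o%:R + 1)) * D <= n * sl.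
    apply: le_trans slk; apply: (@le_trans _ _ ((k%:R - 2 * (o%:R + 1)) * o%:R)).
      by rewrite ler_wpM2l //; lra.
    move: o%:R k%:R o0 kbigR => a b a0 ab.
    have : 0 <= a * (b - 2 * a - 3) by rewrite mulr_ge0 //; lra.
    have : 0 <= (b - 2 * a - 3) ^+ 2 by exact: sqr_ge0.
    lra.
  have gD : g < 2 * D by nra.
  have h : 0 < 2 * D ^+ 2 + - k%:R * D + o%:R by nra.
  have : 2 * D ^+ 2 + - k%:R * D + o%:R <= 0.
    apply: (convex_quadratic_le0 _ Dge Do) => //; last nra.
    rewrite -(pmulr_rle0 _ (exprn_gt0 2 n0)).
    have -> : n ^+ 2 * (2 * (2 * (o%:R + 1) / n) ^+ 2 + - k%:R * (2 * (o%:R + 1) / n) + o%:R)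
      = 8 * (o%:R + 1) ^+ 2 - 2 * k%:R * (o%:R + 1) * n + o%:R * n ^+ 2 by field; lra.
    rewrite /n; move: o%:R k%:R o0 kbigR => a b a0 ab.
    have [y y0 ->] : exists2 y, 0 <= y & b = 2 * a + 3 + y.
      by exists (b - 2 * a - 3); lra.
    have ay : 0 <= a * y by rewrite mulr_ge0.
    have ayy : 0 <= a * (y * y) by rewrite !mulr_ge0.
    have aay : 0 <= a * (a * y) by rewrite !mulr_ge0.
    have aaa : 0 <= a * (a * a) by rewrite !mulr_ge0.
    have aa : 0 <= a * a by rewrite !mulr_ge0.
    have yy : 0 <= y * y by rewrite !mulr_ge0.
    lra.
  lra.
have ksmallR : k%:R <= 2 * o%:R + 2 :> R.
  by rewrite -natrM -natrD ler_nat -ltnS -addnS.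
by apply: (@balanced_absurd o%:R k%:R D g) => //; lra.
Qed.

End Numeric.

(** * The bound for connected graphs *)

Section ConnectedBound.
Variables (R : realType) (n : nat) (e : rel 'I_n) (P : 'M[R]_n) (k m : nat).
Hypotheses (syme : symmetric e) (irre : irreflexive e) (n_gt1 : (1 < n)%N).
Hypotheses (pP : is_proj P) (P1 : P *m const_mx 1 = 0 :> 'cV_n) (trP : \tr P = k%:R).
Hypothesis PL : P *m rel_laplacian R e = rel_laplacian R e *m P.

Let deg i := \sum_j (e i j : nat).
Hypothesis sum_deg : (\sum_i deg i = 2 * m)%N.
Hypothesis deg_gt0 : forall i, (0 < deg i)%N.

Local Notation L := (rel_laplacian R e).
Let X := \tr (P *m L).

Lemma rdegE i : rdeg R e i = (deg i)%:R.
Proof. by rewrite /rdeg natr_sum. Qed.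

(** [P] is orthogonal to the projection [J] onto the constants, so [1 - P - J] is a projection and
    its trace n - k - 1 is nonnegative. *)
Lemma proj_rank_lt : (k < n)%N.
Proof.
pose J : 'M[R]_n := const_mx n%:R^-1.
have n0 : n%:R != 0 :> R by rewrite pnatr_eq0; lia.
have JE : J = n%:R^-1 *: ((const_mx 1 : 'cV_n) *m (const_mx 1 : 'cV_n)^T).
  by apply/matrixP => i j; rewrite !mxE big_ord1 !mxE !mulr1.
have PJ : P *m J = 0 by rewrite JE -scalemxAr mulmxA P1 mul0mx scaler0.
have JP : J *m P = 0.
  rewrite JE -scalemxAl -mulmxA -[in X in _ *m X](proj1 pP) -trmx_mul P1.
  by rewrite trmx0 mulmx0 scaler0.
have JJ : J *m J = J.
  apply/matrixP => i j; rewrite !mxE; under eq_bigr do rewrite !mxE.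
  by rewrite sumr_const card_ord -[LHS]mulr_natl mulrA mulfV ?mul1r.
have pQ : is_proj (1%:M - (P + J)).
  apply: is_projC; split.
    by rewrite linearD /= (proj1 pP) /J trmx_const.
  by rewrite mulmxDl !mulmxDr (proj2 pP) PJ JP JJ addr0 add0r.
have := mxtrace_mul_tr (1%:M - (P + J)); rewrite (proj1 pQ) (proj2 pQ).
rewrite linearB /= linearD /= mxtrace1 trP.
rewrite [\tr J](_ : _ = 1); last first.
  rewrite /mxtrace; under eq_bigr do rewrite mxE.
  by rewrite sumr_const card_ord -[LHS]mulr_natl mulfV.
by rewrite subr_ge0 natr1 ler_nat.
Qed.

Lemma trace_brouwer : 2 * X <= 2 * m%:R + k%:R ^+ 2 + k%:R.
Proof.
have main := brouwer_bound e pP P1 trP.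
rewrite (trace_mul_rel_laplacian syme (proj1 pP)).
have -> : 2 * m%:R = \sum_i \sum_j (e i j)%:R :> R.
  rewrite -natrM -sum_deg natr_sum; apply: eq_bigr => i _.
  by rewrite /deg natr_sum.
rewrite -addrA -lerBlDl -sumrB; apply: le_trans main.
apply: ler_sum => i _; rewrite -sumrB; apply: ler_sum => j _.
lra.
Qed.

(** Adding the nonnegative terms of the non-edges compares with the complete graph, where the sum
    over ordered pairs is 2 n k. *)
Lemma trace_le_all : X <= n%:R * k%:R.
Proof.
rewrite -(ler_pM2l (ltr0n R 2)) (trace_mul_rel_laplacian syme (proj1 pP)).
apply: (@le_trans _ _ (\sum_i \sum_j udist P i j)).
  apply: ler_sum => i _; apply: ler_sum => j _.
  by have := udist_ge0 pP i j; case: (e i j) => /=; lra.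
have -> : \sum_i \sum_j udist P i j = \sum_i (n%:R * P i i + k%:R).
  apply: eq_bigr => i _; rewrite /udist sumrB big_split /= -/(\tr P) trP.
  rewrite sumr_const card_ord -mulr_sumr (proj_row0 _ P1) mulr0 subr0.
  by rewrite -[P i i *+ n]mulr_natl.
rewrite big_split /= -mulr_sumr -/(\tr P) trP sumr_const card_ord.
rewrite -[k%:R *+ n]mulr_natl; lra.
Qed.

Let c i := minn (deg i) k.
Let E : nat := \sum_i (deg i - c i).

Lemma sum_min : (\sum_i c i + E = 2 * m)%N.
Proof.
by rewrite -sum_deg /E -big_split; apply: eq_bigr => i _; rewrite /= subnKC // geq_minl.
Qed.

Lemma trace_grone_merris : X <= 2 * m%:R - E%:R.
Proof.
have := grone_merris_bound pP P1 trP syme.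
rewrite -(trace_mul_rel_laplacian syme (proj1 pP)) ler_pM2l ?ltr0n // => h.
apply: le_trans h _; rewrite -natrM -sum_min natrD addrK natr_sum.
apply: ler_sum => i _; rewrite -/(rdeg R e i) rdegE.
by rewrite /c; case: leqP => h; rewrite ge_min lexx ?orbT.
Qed.

Lemma trace_second_moment :
  X <= k%:R * (k%:R + 1) / 2 + E%:R +
       (\sum_i (c i)%:R * ((c i)%:R + 1)) / (2 * (k%:R + 1)).
Proof.
have k0 : 0 <= k%:R :> R by [].
have := @second_moment _ _ _ syme irre _ pP PL k
  (fun i => (deg i - c i)%N%:R + (c i)%:R * ((c i)%:R + 1) / (2 * (k%:R + 1))) trP.
rewrite big_split /= -natr_sum -mulr_suml addrA; apply.
  by move=> i; rewrite rdegE ler_nat /c => /minn_idPl ->; rewrite subnn add0r.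
move=> i; rewrite rdegE ler_nat /c => h; rewrite (minn_idPr h) natrB //.
rewrite le_eqVlt; apply/orP; left; apply/eqP; field; lra.
Qed.

(** Write n X = 2 k X + (n - 2 k) X; bound the first term by [trace_brouwer] and the second by
    [trace_le_all]. *)
Lemma trace_bound_small : (2 * k <= n)%N ->
  n%:R * X - 2 * m%:R * k%:R <= pineapple_value n%:R ((2 * n) %/ 3)%N%:R.
Proof.
move=> kn; apply: le_trans (pineapple_value_small R n_gt1 kn).
have h1 := trace_brouwer; have h2 := trace_le_all.
have k0 : 0 <= k%:R :> R by [].
have : 2 * k%:R <= n%:R :> R by rewrite -natrM ler_nat.
move: n%:R k%:R m%:R k0 h1 h2 => N K M K0 h1 h2 KN.
have : 0 <= (N - 2 * K) * (N * K - X) by rewrite mulr_ge0 //; lra.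
have : 0 <= K * (2 * M + K ^+ 2 + K - 2 * X) by rewrite mulr_ge0 //; lra.
lra.
Qed.

Lemma trace_bound_large : (n <= 2 * k)%N ->
  n%:R * X - 2 * m%:R * k%:R <= pineapple_value n%:R ((2 * n) %/ 3)%N%:R.
Proof.
move=> nk; have kn := proj_rank_lt.
have k_gt0 : (0 < k)%N by lia.
have k0 : 1 <= k%:R :> R by rewrite ler1n.
set V := pineapple_value n%:R ((2 * n) %/ 3)%N%:R.
have Vk := pineapple_value_max R n_gt1 nk kn; rewrite -/V in Vk.
have [o nE] : exists o, n = (o + k + 1)%N by exists (n - k - 1)%N; lia.
have ok : (o < k)%N by lia.
have o0 : 0 <= o%:R :> R by [].
have okR : o%:R + 1 <= k%:R :> R by rewrite natr1 ler_nat.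
have nER : n%:R = o%:R + k%:R + 1 :> R by rewrite nE !natrD.
have bin : (k * k.+1 = 2 * 'C(k.+1, 2))%N.
  by rewrite bin2 /= mul2n halfK oddM /= andNb subn0 mulnC.
set b := 'C(k.+1, 2) in bin.
have binR : k%:R * (k%:R + 1) = 2 * b%:R :> R by rewrite natr1 -!natrM bin.
(* The pineapple graph with clique size k + 1 has b + o edges, and [p] is the number of edges by
   which the graph falls short of it. *)
pose p : R := (b + o)%:R - m%:R.
have pE : p = b%:R + o%:R - m%:R by rewrite /p natrD.
pose D := o%:R - (2 * m%:R - X).
have n0 : 0 < n%:R :> R by rewrite nER; lra.
(* In these terms n X - 2 m k equals the value of [pineapple_value] at [k] plus n D - 2 (o + 1)
   p. *)
suff Dle : n%:R * D <= 2 * (o%:R + 1) * p + (V - pineapple_value n%:R k%:R).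
  move: Dle; rewrite /D pE /pineapple_value nER.
  have : (o%:R + 1) * (k%:R * (k%:R + 1)) = (o%:R + 1) * (2 * b%:R) :> R by rewrite binR.
  lra.
(* With at least as many edges as the pineapple graph, Brouwer's bound alone gives D <= p <= 0, and
   n >= 2 (o + 1) concludes. *)
have [mb|mb] := leqP (b + o) m.
  have p0 : p <= 0 by rewrite /p subr_le0 ler_nat.
  have Dp : D <= p by have := trace_brouwer; rewrite /D pE; lra.
  have : n%:R * D <= n%:R * p by rewrite ler_pM2l.
  have : 0 <= (n%:R - 2 * (o%:R + 1)) * - p by rewrite nER mulr_ge0 //; lra.
  lra.
have p1 : 1 <= p by rewrite /p lerBrDr addrC natr1 ler_nat.
pose sl := (V - pineapple_value n%:R k%:R) / n%:R.
have slE : n%:R * sl = V - pineapple_value n%:R k%:R.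
  by rewrite /sl mulrC mulfVK // gt_eqF.
have E0 : 0 <= E%:R :> R by [].
pose g : R := 2 * p + E%:R - o%:R.
have gm := trace_grone_merris.
have c_ge1 i : (1 <= c i)%N by rewrite /c leq_min deg_gt0.
have c_lek i : (c i <= k)%N by rewrite /c geq_minr.
(* Degrees truncated at [k] and shifted into [0, k - 1], which uses that they are positive. [key] is
   the second moment bound in these variables, ready for [sum_concave_ge]. *)
pose x i : R := (c i)%:R - 1.
have x01 i : 0 <= x i <= k%:R - 1.
  by rewrite /x subr_ge0 lerD2r ler1n ler_nat c_ge1 c_lek.
have sumc : \sum_i (c i)%:R = 2 * m%:R - E%:R :> R.
  by rewrite -natrM -sum_min natrD natr_sum addrK.
have sumx : \sum_i x i = (k%:R - 1) * k.+1%:R - g.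
  rewrite /x sumrB sumc sumr_const card_ord -natr1 /g pE nER; lra.
have key : 2 * (k%:R + 1) * D <= 2 * o%:R + k%:R * g - \sum_i x i * (k%:R - 1 - x i).
  set S : R := \sum_i (c i)%:R * ((c i)%:R + 1).
  have -> : \sum_i x i * (k%:R - 1 - x i) = (k%:R + 2) * (2 * m%:R - E%:R) - S - n%:R * k%:R.
    rewrite -sumc mulr_sumr -sumrB.
    have -> : n%:R * k%:R = \sum_(i < n) k%:R :> R by rewrite sumr_const card_ord mulr_natl.
    by rewrite -sumrB; apply: eq_bigr => i _; rewrite /x; ring.
  have : 2 * (k%:R + 1) * X <= k%:R * (k%:R + 1) ^+ 2 + 2 * (k%:R + 1) * E%:R + S.
    have -> : k%:R * (k%:R + 1) ^+ 2 + 2 * (k%:R + 1) * E%:R + S = 2 * (k%:R + 1) *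
      (k%:R * (k%:R + 1) / 2 + E%:R + S / (2 * (k%:R + 1))) by field; lra.
    by rewrite ler_pM2l ?trace_second_moment //; lra.
  have : k%:R * (k%:R * (k%:R + 1)) = k%:R * (2 * b%:R) :> R by rewrite binR.
  rewrite nER /g pE /D; lra.
have Dle : D <= 2 * (o%:R + 1) / (o + k + 1)%:R * p + sl.
  apply: (@connected_numeric _ o k p D g sl) => //.
  - by rewrite /D; lra.
  - by rewrite /g /D; lra.
  - by rewrite /sl divr_ge0 ?ler0n // subr_ge0.
  (* [g] is a difference of natural numbers, so g < k improves to g <= k - 1. *)
  - have -> : g = (b + o + (b + o) + E)%:R - (m + m + o)%:R.
      by rewrite /g pE !natrD; ring.
    move: (b + o + (b + o) + E)%N (m + m + o)%N => u v; rewrite ltrBlDr -natrD ltr_nat => uv.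
    by rewrite lerBlDr addrAC -natrD lerBrDr natr1 ler_nat.
  - move=> g0; have : 0 <= \sum_i x i * (k%:R - 1 - x i).
      by apply: sumr_ge0 => i _; have /andP[a1 a2] := x01 i; apply: mulr_ge0; [|rewrite subr_ge0].
    have : k%:R * g <= 0 by rewrite mulr_ge0_le0 // ltW.
    lra.
  - move=> g0 g1; have := sum_concave_ge x01 _ sumx; rewrite g0 g1 => /(_ isT).
    lra.
  (* The required gain is exactly the difference of the values of [pineapple_value] at k - 1 and at
     k, and k - 1 is still at least n / 2. *)
  move=> kbig; rewrite -nE slE.
  have k1 : (n <= 2 * k.-1)%N by lia.
  have k2 : (k.-1 < n)%N by lia.
  have := pineapple_value_max R n_gt1 k1 k2; rewrite -/V.
  have -> : k.-1%:R = k%:R - 1 :> R by rewrite -[in RHS](prednK k_gt0) -natr1 addrK.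
  rewrite /pineapple_value nER; lra.
rewrite -nE in Dle.
have : n%:R * D <= n%:R * (2 * (o%:R + 1) / n%:R * p + sl) by rewrite ler_pM2l.
suff -> : n%:R * (2 * (o%:R + 1) / n%:R * p + sl) = 2 * (o%:R + 1) * p + n%:R * sl.
  by rewrite slE.
by field; rewrite gt_eqF.
Qed.

End ConnectedBound.

(** * Laplacian energy *)

Lemma sum_enum_val (R : nmodType) (T : finType) (F : T -> R) :
  \sum_(i < #|T|) F (enum_val i) = \sum_x F x.
Proof.
rewrite [RHS](reindex (@enum_val T T)) /=; first exact: eq_bigl.
exact/onW_bij/enum_val_bij.
Qed.

Lemma handshake (T : finType) (G : sgraph T) :
  (\sum_x \sum_y (G x y : nat) = 2 * gsize G)%N.
Proof.
pose D := [set p : T * T | G p.1 p.2].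
pose f (p : T * T) := [set p.1; p.2].
have -> : (\sum_x \sum_y (G x y : nat) = \sum_(p in D) 1)%N.
  rewrite pair_big /= [RHS]big_mkcond /=; apply: eq_bigr => p _.
  by rewrite inE; case: (G _ _).
have fiber E : E \in f @: D -> (\sum_(p in D | f p == E) 1 = 2)%N.
  case/imsetP => -[a b]; rewrite inE /= => Gab ->.
  have ab : a != b by apply/eqP => ab; move: Gab; rewrite ab adj_irrefl.
  rewrite (eq_bigl (mem [set (a, b); (b, a)])) => [|[x y]].
    by rewrite sum1_card cards2 xpair_eqE negb_and ab.
  rewrite !inE /= !xpair_eqE; apply/andP/orP => [[Gxy /eqP e]|]; last first.
    case=> /andP[/eqP-> /eqP->]; first by rewrite Gab.
    by rewrite adj_sym Gab /f /= setUC.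
  have : x \in f (a, b) by rewrite -e !inE eqxx.
  have : y \in f (a, b) by rewrite -e !inE eqxx orbT.
  rewrite !inE /= => /orP[]/eqP yE /orP[]/eqP xE; move: Gxy; rewrite xE yE ?adj_irrefl ?eqxx //.
    by right.
  by left.
by rewrite (partition_big_imset f) (eq_bigr _ fiber) sum_nat_const mulnC.
Qed.

Section Energy.
Variables (R : realType) (T : finType) (G : sgraph T).

Definition index_rel : rel 'I_#|T| := fun i j => G (enum_val i) (enum_val j).

Lemma index_rel_sym : symmetric index_rel.
Proof. by move=> i j; rewrite /index_rel adj_sym. Qed.

Lemma index_rel_irrefl : irreflexive index_rel.
Proof. by move=> i; rewrite /index_rel adj_irrefl. Qed.

Lemma laplacian_mxE : laplacian_mx R G = rel_laplacian R index_rel.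
Proof.
apply/matrixP => i j; rewrite !mxE; congr (_ *+ _ - _).
rewrite /rdeg -natr_sum; congr (_%:R).
rewrite (sum_enum_val (fun y => G (enum_val i) y : nat)) /vdegree -sum1dep_card.
by rewrite big_mkcond; apply: eq_bigr => y _; case: (G _ _).
Qed.

Lemma sum_index_rel : (\sum_i \sum_j (index_rel i j : nat) = 2 * gsize G)%N.
Proof.
rewrite -handshake -(sum_enum_val (fun x => (\sum_y G x y)%N)).
by apply: eq_bigr => i _; rewrite (sum_enum_val (fun y => G (enum_val i) y : nat)).
Qed.

(** The differences x - d sum to 0, and |y| + y is twice the positive part of y. *)
Lemma laplacian_energyE (d : R) : d = (2 * gsize G)%:R / #|T|%:R -> (0 < #|T|)%N ->
  laplacian_energy R G = 2 * \sum_(x <- eigenvalues (laplacian_mx R G)) Num.max (x - d) 0.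
Proof.
move=> dE T0; rewrite /laplacian_energy -dE.
set A := laplacian_mx R G; have symA : A^T = A := laplacian_mx_sym R G.
have szA := size_eigenvalues symA; set s := eigenvalues A in szA *.
have -> : \sum_(i < #|T|) `|s`_i - d| = \sum_(x <- s) `|x - d|.
  by rewrite (big_nth 0) big_mkord szA.
have trs : \sum_(x <- s) x = (2 * gsize G)%:R.
  rewrite -(char_poly_roots_trace (char_poly_eigenvalues symA)) /A laplacian_mxE /mxtrace.
  rewrite -sum_index_rel natr_sum; apply: eq_bigr => i _.
  by rewrite (rel_laplacian_diag _ index_rel_irrefl) /rdeg natr_sum.
have sum0 : \sum_(x <- s) (x - d) = 0.
  rewrite sumrB trs big_const_seq count_predT szA iter_addr_0 -[d *+ _]mulr_natr.
  by rewrite dE divfK ?subrr // pnatr_eq0 -lt0n.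
rewrite mulr_sumr -[LHS]addr0 -[X in _ + X]sum0 -big_split; apply: eq_bigr => x _ /=.
case: (lerP (x - d) 0) => h; first by rewrite ler0_norm //; ring.
by rewrite gtr0_norm //; ring.
Qed.

Lemma laplacian_energy_le (V : R) : (1 < #|T|)%N ->
  (forall x, exists y, G x y) ->
  V = pineapple_value #|T|%:R ((2 * #|T|) %/ 3)%N%:R ->
  laplacian_energy R G <= 2 * (V / #|T|%:R).
Proof.
move=> T1 Gdeg VE; have T0 : (0 < #|T|)%N by apply: ltnW.
rewrite (laplacian_energyE erefl T0) ler_pM2l ?ltr0n //.
set d : R := _ / _.
have d0 : 0 <= d by rewrite divr_ge0 ?ler0n.
have [P [k [pP PL trP <- P0]]] := proj_above d (laplacian_mx_sym R G).
have P1 : P *m const_mx 1 = 0 :> 'cV_ _.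
  by apply: P0 => //; rewrite laplacian_mxE; exact: rel_laplacian1.
rewrite laplacian_mxE in PL *.
have deg0 i : (0 < \sum_j (index_rel i j : nat))%N.
  have [y Gy] := Gdeg (enum_val i).
  rewrite (bigD1 (enum_rank y)) //= /index_rel enum_rankK Gy //.
have n0 : 0 < #|T|%:R :> R by rewrite ltr0n.
rewrite ler_pdivlMr // VE.
have -> : (\tr (P *m rel_laplacian R index_rel) - d * k%:R) * #|T|%:R =
    #|T|%:R * \tr (P *m rel_laplacian R index_rel) - 2 * (gsize G)%:R * k%:R.
  by rewrite /d natrM; field; rewrite gt_eqF.
case: (leqP (2 * k) #|T|) => h.
  exact: (trace_bound_small index_rel_sym T1 pP P1 trP sum_index_rel h).
exact: (trace_bound_large index_rel_sym index_rel_irrefl T1 pP P1 trP PL sum_index_rel deg0 (ltnW h)).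
Qed.

Lemma laplacian_energy_ge (P : 'M[R]_#|T|) : (0 < #|T|)%N -> is_proj P ->
  2 * (\tr (P *m laplacian_mx R G) - (2 * gsize G)%:R / #|T|%:R * \tr P) <=
  laplacian_energy R G.
Proof.
move=> T0 pP; rewrite (laplacian_energyE erefl T0) ler_pM2l ?ltr0n //.
exact: trace_proj_le (laplacian_mx_sym R G) pP.
Qed.

End Energy.

(** * The pineapple graph *)

Section Pineapple.
Variables (R : realType) (n k : nat).
Hypotheses (n_gt1 : (1 < n)%N) (k_gt0 : (0 < k)%N) (kn : (k < n)%N).

Lemma is_projD (P Q : 'M[R]_n) : is_proj P -> is_proj Q -> P *m Q = 0 -> is_proj (P + Q).
Proof.
move=> [sP PP] [sQ QQ] PQ; split; first by rewrite linearD /= sP sQ.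
have QP : Q *m P = 0 by rewrite -sP -sQ -trmx_mul PQ trmx0.
by rewrite mulmxDl !mulmxDr PP QQ PQ QP addr0 add0r.
Qed.

Lemma is_projB (P Q : 'M[R]_n) : is_proj P -> is_proj Q -> P *m Q = Q -> is_proj (P - Q).
Proof.
move=> [sP PP] [sQ QQ] PQ; split; first by rewrite linearB /= sP sQ.
have QP : Q *m P = Q by rewrite -{1}sQ -sP -trmx_mul PQ sQ.
by rewrite mulmxBl !mulmxBr PP QQ PQ QP subrr subr0.
Qed.

Lemma is_proj_rank1 (v : 'cV[R]_n) (s : R) : s != 0 -> v^T *m v = s%:M ->
  is_proj (s^-1 *: (v *m v^T)).
Proof.
move=> s0 vv; split; first by rewrite linearZ /= trmx_mul trmxK.
rewrite -scalemxAl -scalemxAr scalerA mulmxA -[_ *m _ *m v]mulmxA vv.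
by rewrite mul_mx_scalar -scalemxAl scalerA mulfVK.
Qed.

(** Indicators of the centre, the other clique vertices and the pendant vertices, for clique size k
    + 1. *)
Let z (x : 'I_n) : R := (x == 0%N :> nat)%:R.
Let c (x : 'I_n) : R := (0 < x <= k)%N%:R.
Let t (x : 'I_n) : R := (k < x)%N%:R.
Let v x := n%:R * z x - 1.

Local Lemma sum_z : \sum_x z x = 1.
Proof.
have n0 : (0 < n)%N by apply: ltnW.
rewrite (bigD1 (Ordinal n0)) //= big1 ?addr0 // => x.
by rewrite /z -val_eqE /= => /negPf ->.
Qed.

Local Lemma sum_c : \sum_x c x = k%:R.
Proof.
rewrite /c -natr_sum -(big_mkord xpredT (fun x => (0 < x <= k)%N : nat)).
rewrite (big_cat_nat (n := k.+1)) //= [X in (_ + X)%N]big1_seq ?addn0; last first.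
  by move=> x; rewrite mem_index_iota => /andP[_ /andP[h _]]; rewrite (leqNgt x k) h andbF.
rewrite big_nat_recl //= add0n (eq_big_nat _ _ (F2 := fun=> 1%N)) ?sum_nat_const_nat ?subn0 ?muln1 //.
by move=> x /= ->.
Qed.

Local Lemma zct x : z x + c x + t x = 1.
Proof.
rewrite /z /c /t lt0n (leqNgt x k); case: eqP => [->|_] /=; first by rewrite ?ltn0 /=; ring.
by case: (k < x)%N => /=; ring.
Qed.

Local Lemma sum_t : \sum_x t x = n%:R - 1 - k%:R.
Proof.
rewrite (eq_bigr (fun x => 1 - z x - c x)) => [|x _]; last by rewrite -(zct x); ring.
by rewrite !sumrB sum_z sum_c sumr_const card_ord.
Qed.

(** The projection onto the sum of two Laplacian eigenspaces: the vectors of sum zero on the [k]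
    clique vertices other than the centre, with eigenvalue k + 1, and the line of [v], with
    eigenvalue n since the centre is adjacent to all other vertices. Here |v|^2 = n (n - 1). *)
Definition pineapple_proj : 'M[R]_n :=
  diag_mx (\row_x c x) - k%:R^-1 *: ((\col_x c x) *m (\col_x c x)^T)
  + (n%:R * (n%:R - 1))^-1 *: ((\col_x v x) *m (\col_x v x)^T).

Local Lemma cc x : c x * c x = c x.
Proof. by rewrite /c; case: (_ < _ <= _)%N; rewrite ?mulr1 ?mulr0. Qed.

Local Lemma cv x : c x * v x = - c x.
Proof.
rewrite /v /c /z; case: (nat_of_ord x) => [|m] /=; first by rewrite !mul0r oppr0.
by rewrite mulr0 sub0r mulrN1.
Qed.

Lemma pineapple_projP : is_proj pineapple_proj.
Proof.
have k0 : k%:R != 0 :> R by rewrite pnatr_eq0 -lt0n.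
have n1 : 1 < n%:R :> R by rewrite ltr1n.
have N0 : n%:R * (n%:R - 1) != 0 :> R by rewrite mulf_neq0 // gt_eqF //; lra.
have dot (a b : 'I_n -> R) s : \sum_x a x * b x = s ->
    (\col_x a x)^T *m (\col_x b x) = s%:M.
  move=> <-; apply/matrixP => i j; rewrite !mxE !ord1 mulr1n.
  by apply: eq_bigr => x _; rewrite !mxE.
have Dmul (a : 'I_n -> R) : diag_mx (\row_x c x) *m (\col_x a x) = \col_x (c x * a x).
  by apply/colP => i; rewrite mul_diag_mx !mxE.
apply: is_projD; first apply: is_projB.
- split; first by rewrite tr_diag_mx.
  by rewrite mulmx_diag; congr diag_mx; apply/rowP => i; rewrite !mxE cc.
- apply: is_proj_rank1 => //; apply: dot.
  by rewrite (eq_bigr c) ?sum_c // => x _; rewrite cc.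
- rewrite -scalemxAr mulmxA Dmul; congr (_ *: (_ *m _)).
  by apply/colP => i; rewrite !mxE cc.
- apply: is_proj_rank1 => //; apply: dot.
  rewrite (eq_bigr (fun x => (n%:R * (n%:R - 2)) * z x + 1)); last first.
    by move=> x _; rewrite /v /z; case: (_ == _) => /=; ring.
  by rewrite big_split -mulr_sumr /= sum_z sumr_const card_ord; ring.
rewrite -scalemxAr mulmxA mulmxBl Dmul -scalemxAl -[_ *m _ *m (\col_x v x)]mulmxA.
rewrite (dot _ _ (- k%:R)); last first.
  by rewrite (eq_bigr (fun x => - c x)) ?sumrN ?sum_c // => x _; rewrite cv.
rewrite mul_mx_scalar scalerA mulrN mulVf // scaleN1r opprK.
rewrite (_ : \col_x (c x * v x) + \col_x c x = 0) ?mul0mx ?scaler0 //.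
by apply/colP => i; rewrite !mxE cv addNr.
Qed.

Lemma pineapple_projE x y : pineapple_proj x y =
  c x *+ (x == y) - k%:R^-1 * (c x * c y) + (n%:R * (n%:R - 1))^-1 * (v x * v y).
Proof. by rewrite !mxE !big_ord1 !mxE. Qed.

Lemma pineapple_proj_trace : \tr pineapple_proj = k%:R.
Proof.
have k0 : k%:R != 0 :> R by rewrite pnatr_eq0 -lt0n.
have n1 : 1 < n%:R :> R by rewrite ltr1n.
rewrite /mxtrace (eq_bigr (fun x => (1 - k%:R^-1) * c x +
  (n%:R * (n%:R - 1))^-1 * ((n%:R * (n%:R - 2)) * z x + 1))); last first.
  move=> x _; rewrite pineapple_projE eqxx mulr1n cc /v /z.
  by case: (_ == _) => /=; ring.
rewrite big_split -!mulr_sumr big_split -mulr_sumr /= sum_z sum_c sumr_const card_ord.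
field; rewrite k0 /=; lra.
Qed.

Local Notation PA := (pineapple n k.+1).

Lemma pineapple_adjE x y : (PA x y)%:R = c x * c y - c x * (x == y)%:R
  + (z x * (c y + t y) + (c x + t x) * z y) :> R.
Proof.
rewrite /= /pineapple_adj /z /c /t -val_eqE /=.
case: (nat_of_ord x) (nat_of_ord y) => [|a] [|b] /=; rewrite ?eqxx ?ltn0 ?ltnS /=; try ring.
- by case: ltnP => h /=; ring.
- by case: ltnP => h /=; ring.
by case: eqP => [[->]|_]; case: (b < k)%N; case: (a < k)%N => /=; ring.
Qed.

Lemma pineapple_adj_udist x y : (PA x y)%:R * udist pineapple_proj x y =
  2 * (c x * c y - c x * (x == y)%:R)
  + (1 - k%:R^-1 + n%:R / (n%:R - 1)) * (z x * c y + c x * z y)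
  + n%:R / (n%:R - 1) * (z x * t y + t x * z y).
Proof.
have k0 : k%:R != 0 :> R by rewrite pnatr_eq0 -lt0n.
have n1 : 1 < n%:R :> R by rewrite ltr1n.
rewrite pineapple_adjE /udist !pineapple_projE !eqxx !mulr1n -mulr_natr !cc /v.
rewrite /z /c /t -val_eqE /=; move: (n%:R : R) (k%:R : R) k0 n1 => N K K0 N1.
case: (nat_of_ord x) (nat_of_ord y) => [|a] [|b] /=; rewrite ?eqxx ?ltn0 ?ltnS /=.
- by field; rewrite K0 /=; lra.
- by case: ltnP => h /=; field; rewrite K0 /=; lra.
- by case: ltnP => h /=; field; rewrite K0 /=; lra.
by case: eqP => [[->]|_]; case: (b < k)%N; case: (a < k)%N => /=; field; rewrite K0 /=; lra.
Qed.

Lemma sum_sum_mul (a b : 'I_n -> R) :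
  \sum_x \sum_y a x * b y = (\sum_x a x) * (\sum_y b y).
Proof. by rewrite mulr_suml; apply: eq_bigr => x _; rewrite mulr_sumr. Qed.

Lemma sum_sum_diag (a : 'I_n -> R) : \sum_x \sum_y a x * (x == y)%:R = \sum_x a x.
Proof.
apply: eq_bigr => x _; rewrite (bigD1 x) //= eqxx mulr1 big1 ?addr0 // => y.
by rewrite eq_sym => /negPf ->; rewrite mulr0.
Qed.

Lemma pineapple_size :
  (2 * gsize PA)%:R = k%:R * (k%:R + 1) + 2 * (n%:R - 1 - k%:R) :> R.
Proof.
rewrite -handshake natr_sum.
have -> : \sum_x (\sum_y (PA x y : nat))%:R = \sum_x \sum_y (c x * c y - c x * (x == y)%:R
    + (z x * (c y + t y) + (c x + t x) * z y)) :> R.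
  by apply: eq_bigr => x _; rewrite natr_sum; apply: eq_bigr => y _; exact: pineapple_adjE.
have -> : \sum_x \sum_y (c x * c y - c x * (x == y)%:R
    + (z x * (c y + t y) + (c x + t x) * z y)) =
  \sum_x \sum_y c x * c y - \sum_x \sum_y c x * (x == y)%:R
  + (\sum_x \sum_y z x * (c y + t y) + \sum_x \sum_y (c x + t x) * z y).
  rewrite -sumrB -!big_split; apply: eq_bigr => x _ /=.
  by rewrite -sumrB -!big_split.
rewrite sum_sum_diag !sum_sum_mul !big_split /= sum_c sum_t sum_z; ring.
Qed.

(** Twice the sum of the eigenvalues n, once, and k + 1, taken k - 1 times. *)
Lemma pineapple_trace : \sum_x \sum_y (PA x y)%:R * udist pineapple_proj x y =
  2 * (k%:R ^+ 2 - 1 + n%:R).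
Proof.
have k0 : k%:R != 0 :> R by rewrite pnatr_eq0 -lt0n.
have n1 : 1 < n%:R :> R by rewrite ltr1n.
pose al : R := 1 - k%:R^-1 + n%:R / (n%:R - 1); pose be : R := n%:R / (n%:R - 1).
have -> : \sum_x \sum_y (PA x y)%:R * udist pineapple_proj x y =
  2 * (\sum_x \sum_y c x * c y - \sum_x \sum_y c x * (x == y)%:R)
  + al * (\sum_x \sum_y z x * c y + \sum_x \sum_y c x * z y)
  + be * (\sum_x \sum_y z x * t y + \sum_x \sum_y t x * z y).
  rewrite -sumrB -!big_split !mulr_sumr -!big_split; apply: eq_bigr => x _ /=.
  rewrite -sumrB -!big_split !mulr_sumr -!big_split; apply: eq_bigr => y _ /=.
  exact: pineapple_adj_udist.
rewrite sum_sum_diag !sum_sum_mul sum_c sum_t sum_z /al /be; field.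
by rewrite k0 /=; lra.
Qed.

Lemma pineapple_energy_ge :
  2 * (pineapple_value n%:R k%:R / n%:R) <= laplacian_energy R PA.
Proof.
have n0 : n%:R != 0 :> R by rewrite pnatr_eq0 -lt0n ltnW.
have [symP idP] := pineapple_projP.
pose P : 'M[R]_#|'I_n| := \matrix_(i, j) pineapple_proj (enum_val i) (enum_val j).
have PE i j : P i j = pineapple_proj (enum_val i) (enum_val j) by rewrite [LHS]mxE.
have pP : is_proj P.
  move: (P) PE => Q QE.
  split; apply/matrixP => i j; rewrite [LHS]mxE !QE; first by rewrite -[in RHS]symP [RHS]mxE.
  rewrite -[in RHS]idP [RHS]mxE -(sum_enum_val (fun y => pineapple_proj _ y * pineapple_proj y _)).
  by apply: eq_bigr => l _; rewrite !QE.
have trP : \tr P = k%:R.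
  rewrite -pineapple_proj_trace /mxtrace -(sum_enum_val (fun y => pineapple_proj y y)).
  by apply: eq_bigr => l _; rewrite PE.
have T0 : (0 < #|'I_n|)%N by rewrite card_ord ltnW.
apply: le_trans (laplacian_energy_ge PA T0 pP).
rewrite trP [X in _ / X%:R * _]card_ord pineapple_size ler_pM2l ?ltr0n //.
have -> : \tr (P *m laplacian_mx R PA) = k%:R ^+ 2 - 1 + n%:R.
  apply: (@mulfI _ 2); first by rewrite pnatr_eq0.
  rewrite laplacian_mxE (trace_mul_rel_laplacian (index_rel_sym _) (proj1 pP)) -pineapple_trace.
  rewrite -(sum_enum_val (fun x => \sum_y (PA x y)%:R * udist pineapple_proj x y)).
  apply: eq_bigr => i _.
  rewrite -(sum_enum_val (fun y => (PA (enum_val i) y)%:R * udist pineapple_proj (enum_val i) y)).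
  by apply: eq_bigr => j _; rewrite /udist !PE.
rewrite le_eqVlt; apply/orP; left; apply/eqP; rewrite /pineapple_value.
by field; rewrite n0.
Qed.

End Pineapple.

Theorem theorem2p5 (R : realType) (n : nat) (T : finType) (G : sgraph T)
    (hn : (2 <= n)%N) (hT : #|T| = n) (hG : connected_graph G) :
  laplacian_energy R G
    <= laplacian_energy R (pineapple n (1 + (2 * n) %/ 3)).
Proof.
have T1 : (1 < #|T|)%N by rewrite hT.
have Gdeg x : exists y, G x y.
  have [y yx] : exists y, y != x.
    have /card_gt1P[a [b [_ _ ab]]] := T1.
    by have [ax|ax] := eqVneq a x; [exists b; rewrite -ax eq_sym|exists a].
  have /connectP[[|u p] /=] := hG.2 x y; first by move=> _ e; rewrite e eqxx in yx.
  by case/andP=> Gxu _ _; exists u.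
apply: le_trans (laplacian_energy_le T1 Gdeg erefl) _.
rewrite hT add1n; apply: pineapple_energy_ge => //.
  by rewrite divn_gt0 //; lia.
by rewrite ltn_divLR //; lia.
Qed.
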